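(* For all $a\in\mathcal W_A^{ss}(\mathfrak C^{eq})$ and $b\in\mathcal W_A(\mathfrak C^{eq})$, $a$ is independent from $b$ over $m_A(a,b)$, that is, $\mathrm{tp}(a/m_A(a,b)\,b)$ does not fork over $m_A(a,b)$.
   Context: $T$ is an arbitrary (possibly multi-sorted) complete first-order theory with monster model $\mathfrak C$; $A$ is a small parameter set. For a complete type $p\in S(A)$, $p(\mathfrak C)$ is its set of realizations (in $\mathfrak C^{eq}$ if $p$ is a type of imaginaries); a set $X\subseteq p(\mathfrak C)^n$ is relatively $B$-definable if $X=\phi(\mathfrak C)\cap p(\mathfrak C)^n$ for some $L_B$-formula $\phi$, and relatively definable if it is so for some $B$. A weakly o-minimal pair over $A$ is $\mathbf p=(p,<)$ where $p\in S(A)$, $<$ is a relatively $A$-definable linear order on $p(\mathfrak C)$, and every relatively definable subset of $p(\mathfrak C)$ is a finite union of $<$-convex subsets of $p(\mathfrak C)$. A type $p\in S(A)$ is weakly o-minimal if there is a weakly o-minimal pair $(p,<)$ over $A$. $\mathcal E_p$ is the set of all relatively $A$-definable equivalence relations on $p(\mathfrak C)$. A $\mathbf p$-semiinterval is a convex subset $S$ of $(p(\mathfrak C),<)$ such that $a=\min S$ exists and $S$ is relatively $Aa$-definable within $p(\mathfrak C)$. It is $\mathcal E_p$-determined if $S=\{x\in[a]_E\mid a\leqslant x\}$ for some $E\in\mathcal E_p$. The type $p$ has simple semiintervals if for every weakly o-minimal pair $\mathbf p=(p,<_p)$ over $A$, every $\mathbf p$-semiinterval is $\mathcal E_p$-determined.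 Notation: $\mathcal W_A(\mathfrak C^{eq})$ is the set of $a\in\mathfrak C^{eq}$ such that $\mathrm{tp}(a/A)$ is weakly o-minimal; $\mathcal W_A^{ss}(\mathfrak C^{eq})$ is the set of $a\in\mathcal W_A(\mathfrak C^{eq})$ such that $\mathrm{tp}(a/A)$ has simple semiintervals; $m_A(a,b)=\mathrm{dcl}^{eq}(Aa)\cap\mathrm{dcl}^{eq}(Ab)$. *)

(* Defs.v *)
From mathcomp Require Import all_boot.
From mathcomp Require Import boolp classical_sets functions cardinality.

Set Implicit Arguments.
Unset Strict Implicit.
Unset Printing Implicit Defensive.

Local Open Scope classical_set_scope.
Local Open Scope card_scope.

Record signature := Signature {
  sorts : Type;
  func : Type;
  fdom : func -> seq sorts;
  fcod : func -> sorts;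
  rel : Type;
  rdom : rel -> seq sorts
}.

Fixpoint env (S : Type) (F : S -> Type) (G : seq S) : Type :=
  if G is s :: G' then (F s * env F G')%type else unit.

Fixpoint env_cat (S : Type) (F : S -> Type) (G D : seq S) :
    env F G -> env F D -> env F (G ++ D) :=
  match G return env F G -> env F D -> env F (G ++ D) with
  | [::] => fun _ y => y
  | s :: G' => fun x y => (x.1, env_cat x.2 y)
  end.

Fixpoint env_map (S : Type) (F F' : S -> Type) (f : forall s, F s -> F' s)
    (G : seq S) : env F G -> env F' G :=
  match G return env F G -> env F' G with
  | [::] => fun _ => tt
  | s :: G' => fun x => (f s x.1, env_map f x.2)
  end.

Fixpoint env_in (S : Type) (F : S -> Type) (B : set {s : S & F s})
    (G : seq S) : env F G -> Prop :=
  match G return env F G -> Prop with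
  | [::] => fun _ => True
  | s :: G' => fun x => B (existT F s x.1) /\ env_in B x.2
  end.

(* Typed de Bruijn indices: [var G s] are the positions of sort [s] in [G]. *)
Inductive var (S : Type) : seq S -> S -> Type :=
| VZ G s : var (s :: G) s
| VS G s t : var G s -> var (t :: G) s.

Fixpoint lookup (S : Type) (F : S -> Type) (G : seq S) (s : S)
    (v : var G s) : env F G -> F s :=
  match v in var G s return env F G -> F s with
  | VZ _ _ => fun x => x.1
  | VS _ _ _ v' => fun x => lookup v' x.2
  end.

Section Syntax.
Variable L : signature.

Inductive term (G : seq (sorts L)) : sorts L -> Type :=
| Var s : var G s -> term G s
| App f : terms G (fdom f) -> term G (fcod f)
with terms (G : seq (sorts L)) : seq (sorts L) -> Type :=
| TNil : terms G [::]
| TCons s D : term G s -> terms G D -> terms G (s :: D).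

(* [formula G]: formulas whose free variables are among the context [G]. *)
Inductive formula : seq (sorts L) -> Type :=
| FEq G s : term G s -> term G s -> formula G
| FRel G r : terms G (rdom r) -> formula G
| FFalse G : formula G
| FImp G : formula G -> formula G -> formula G
| FAll G s : formula (s :: G) -> formula G.

Definition FNot G (phi : formula G) : formula G := FImp phi (FFalse G).

Record structure := Structure {
  carrier :> sorts L -> Type;
  inh : forall s, inhabited (carrier s);
  fint : forall f, env carrier (fdom f) -> carrier (fcod f);
  rint : forall r, env carrier (rdom r) -> Prop
}.

Section Semantics.
Variable M : structure.

Fixpoint eval G s (t : term G s) (x : env M G) : M s :=
  match t in term _ s return M s with
  | Var _ v => lookup v x
  | App _ ts => fint (evals ts x)
  end
with evals G D (ts : terms G D) (x : env M G) : env M D :=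
  match ts in terms _ D return env M D with
  | TNil => tt
  | TCons _ _ t ts' => (eval t x, evals ts' x)
  end.

Fixpoint sat G (phi : formula G) : env M G -> Prop :=
  match phi in formula G return env M G -> Prop with
  | FEq _ _ t u => fun x => eval t x = eval u x
  | FRel _ _ ts => fun x => rint (evals ts x)
  | FFalse _ => fun _ => False
  | FImp _ phi1 phi2 => fun x => sat phi1 x -> sat phi2 x
  | FAll G' s phi1 => fun x => forall a : M s, sat phi1 ((a, x) : env M (s :: G'))
  end.

End Semantics.

Definition theory := set (formula [::]).

Definition models (T : theory) (M : structure) : Prop :=
  forall phi, T phi -> sat phi (tt : env M [::]).

Definition entails (T : theory) (phi : formula [::]) : Prop :=
  forall M, models T M -> sat phi (tt : env M [::]).

Definition complete_theory (T : theory) : Prop :=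
  (exists M, models T M) /\ forall phi, entails T phi \/ entails T (FNot phi).

Section Types.
Variable M : structure.

Definition elt : Type := {s : sorts L & M s}.

Definition mk_elt (s : sorts L) (x : M s) : elt := existT M s x.

Record pformula (D : seq (sorts L)) := PFormula {
  pctx : seq (sorts L);
  pbody : formula (D ++ pctx);
  pval : env M pctx
}.

Definition over (B : set elt) D (phi : pformula D) : Prop :=
  env_in B (pval phi).

Definition psat D (phi : pformula D) (x : env M D) : Prop :=
  sat (pbody phi) (env_cat x (pval phi)).

Definition pnot D (phi : pformula D) : pformula D :=
  PFormula (FNot (pbody phi)) (pval phi).

Definition realizes D (p : set (pformula D)) (x : env M D) : Prop :=
  forall phi, p phi -> psat phi x.

Definition consistent D (p : set (pformula D)) : Prop :=
  forall n (phi : 'I_n -> pformula D), (forall i, p (phi i)) ->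
    exists x, forall i, psat (phi i) x.

(* [p] belongs to [S_D(B)]. *)
Definition complete_type (B : set elt) D (p : set (pformula D)) : Prop :=
  [/\ p `<=` over B (D := D), consistent p &
      forall phi, over B phi -> p phi \/ p (pnot phi)].

Definition tp (B : set elt) D (x : env M D) : set (pformula D) :=
  [set phi | over B phi /\ psat phi x].

Definition env1 s (x : M s) : env M [:: s] := (x, tt).

Definition elt_env (a : elt) : env M [:: projT1 a] := env1 (projT2 a).

Definition dcl (B : set elt) : set elt :=
  [set b | exists phi : pformula [:: projT1 b],
     [/\ over B phi, psat phi (elt_env b) &
         forall y, psat phi (env1 y) -> y = projT2 b]].

(* [phi(x; c)] divides over [B]: for some [k] there is a sequence of
   realizations [c_i] of [tp(c/B)] with [{phi(x; c_i)}] [k]-inconsistent. *)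
Definition divides (B : set elt) D (phi : pformula D) : Prop :=
  exists (k : nat) (c : nat -> env M (pctx phi)),
    (forall i, tp B (c i) = tp B (pval phi)) /\
    forall i : 'I_k -> nat, injective i ->
      ~ exists x, forall j, psat (PFormula (pbody phi) (c (i j))) x.

(* Implication is read in [M]; this is meant for [M] saturated and [p] a set
   of formulas over a small set. *)
Definition forks (B : set elt) D (p : set (pformula D)) : Prop :=
  exists n (phi : 'I_n -> pformula D),
    (forall i, divides B (phi i)) /\
    forall x, realizes p x -> exists i, psat (phi i) x.

Definition independent (B : set elt) (a b : elt) : Prop :=
  ~ forks B (tp (B `|` [set b]) (elt_env a)).

(* This is [m_A(a,b)] when [M] is an imaginary expansion, where [dcl] is
   [dcl^eq]. *)
Definition meet_dcl (A : set elt) (a b : elt) : set elt :=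
  dcl (A `|` [set a]) `&` dcl (A `|` [set b]).

Section OneTypes.
Variables (A : set elt) (s : sorts L) (p : set (pformula [:: s])).

Definition locus : set (M s) := [set x | realizes p (env1 x)].

Fixpoint env_power (X : set (M s)) (n : nat) : set (env M (nseq n s)) :=
  match n return set (env M (nseq n s)) with
  | 0 => setT
  | n'.+1 => [set x | X x.1 /\ env_power X x.2]
  end.

Definition rel_definable (B : set elt) (n : nat)
    (X : set (env M (nseq n s))) : Prop :=
  exists phi : pformula (nseq n s),
    over B phi /\ X = [set x | psat phi x] `&` @env_power locus n.

Definition rel_definable1 (B : set elt) (X : set (M s)) : Prop :=
  rel_definable B (n := 1) [set x | X x.1].

Definition rel_definable2 (B : set elt) (R : M s -> M s -> Prop) : Prop :=
  rel_definable B (n := 2) [set x | R x.1 x.2.1].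

Definition linear_order_on (X : set (M s)) (lt : M s -> M s -> Prop) : Prop :=
  [/\ forall x, X x -> ~ lt x x,
      forall x y z, X x -> X y -> X z -> lt x y -> lt y z -> lt x z &
      forall x y, X x -> X y -> [\/ lt x y, x = y | lt y x]].

Definition convex_in (X : set (M s)) (lt : M s -> M s -> Prop)
    (Y : set (M s)) : Prop :=
  Y `<=` X /\
  forall x y z, Y x -> Y y -> X z -> lt x z -> lt z y -> Y z.

Definition wom_pair (lt : M s -> M s -> Prop) : Prop :=
  [/\ complete_type A p,
      rel_definable2 A lt,
      linear_order_on locus lt &
      forall (B : set elt) (X : set (M s)), rel_definable1 B X ->
        exists n (Y : 'I_n -> set (M s)),
          (forall i, convex_in locus lt (Y i)) /\ X = \bigcup_i Y i].

Definition weakly_o_minimal : Prop := exists lt, wom_pair lt.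

(* [E] belongs to [E_p]; by [rel_definable2] it only relates realizations. *)
Definition rel_definable_equiv (E : M s -> M s -> Prop) : Prop :=
  [/\ rel_definable2 A E,
      forall x, locus x -> E x x,
      forall x y, E x y -> E y x &
      forall x y z, E x y -> E y z -> E x z].

Definition is_minimum (lt : M s -> M s -> Prop) (S : set (M s)) (a : M s) :
    Prop :=
  S a /\ forall x, S x -> a = x \/ lt a x.

Definition semiinterval (lt : M s -> M s -> Prop) (S : set (M s)) : Prop :=
  convex_in locus lt S /\
  exists a, is_minimum lt S a /\ rel_definable1 (A `|` [set mk_elt a]) S.

Definition Ep_determined (lt : M s -> M s -> Prop) (S : set (M s)) : Prop :=
  exists a E, [/\ is_minimum lt S a, rel_definable_equiv E &
    S = [set x | E a x /\ (a = x \/ lt a x)]].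

Definition simple_semiintervals : Prop :=
  forall lt, wom_pair lt ->
  forall S, semiinterval lt S -> Ep_determined lt S.

End OneTypes.

Definition W (A : set elt) : set elt :=
  [set a | weakly_o_minimal A (tp A (elt_env a))].

Definition Wss (A : set elt) : set elt :=
  [set a | W A a /\ simple_semiintervals A (tp A (elt_env a))].

Definition automorphism (g : forall s, M s -> M s) : Prop :=
  [/\ forall s, bijective (g s),
      forall f (x : env M (fdom f)), g _ (fint x) = fint (env_map g x) &
      forall r (x : env M (rdom r)), rint x <-> rint (env_map g x)].

Definition elementary_on (B : set elt) (g : forall s, M s -> M s) : Prop :=
  forall G (phi : formula G) (x : env M G), env_in B x ->
    sat phi x <-> sat phi (env_map g x).

(* Cardinals are represented by types: [X] has cardinality [< |K|]. *)
Definition small (K U : Type) (X : set U) : Prop := ~ ([set: K] #<= X).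

Definition saturated (K : Type) : Prop :=
  forall B, small K B -> forall s (p : set (pformula [:: s])),
    complete_type B p -> exists x, realizes p x.

(* [g] is total, but only its restriction to [B] matters. *)
Definition strongly_homogeneous (K : Type) : Prop :=
  forall B, small K B -> forall g, elementary_on B g ->
    exists2 h, automorphism h &
      forall s (x : M s), B (mk_elt x) -> h s x = g s x.

End Types.

(* [C] is a [|K|]-saturated, strongly [|K|]-homogeneous model of [T], where
   [|K|] exceeds the number of formulas (so [|K|] is uncountable). *)
Definition monster (K : Type) (T : theory) (C : structure) : Prop :=
  [/\ models T C, small K [set: {G : seq (sorts L) & formula G}],
      saturated C K & strongly_homogeneous C K].

End Syntax.

Section Imaginaries.
Variables (L : signature) (M : structure L).

(* [0]-definable equivalence relations on finite products of sorts; each of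
   them indexes a sort of imaginaries. *)
Record def_equiv := DefEquiv {
  eq_ctx : seq (sorts L);
  eq_formula : formula (eq_ctx ++ eq_ctx);
  eq_holds := fun x y : env M eq_ctx => sat eq_formula (env_cat x y);
  eq_refl : forall x, eq_holds x x;
  eq_sym : forall x y, eq_holds x y -> eq_holds y x;
  eq_trans : forall x y z, eq_holds x y -> eq_holds y z -> eq_holds x z
}.

(* The home sorts of [L] are kept as [inl s]; the function symbol [inr E] is the
   projection onto the sort of [E]-classes. *)
Definition eq_signature : signature := {|
  sorts := (sorts L + def_equiv)%type;
  func := (func L + def_equiv)%type;
  fdom := fun f => match f with
                   | inl f => map inl (fdom f)
                   | inr E => map inl (eq_ctx E)
                   end;
  fcod := fun f => match f with
                   | inl f => inl (fcod f)
                   | inr E => inr E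
                   end;
  rel := rel L;
  rdom := fun r => map inl (rdom r)
|}.

Definition eq_class (E : def_equiv) (x : env M (eq_ctx E)) :
    set (env M (eq_ctx E)) := [set y | eq_holds x y].

Definition eq_carrier (s : sorts eq_signature) : Type :=
  match s with
  | inl s => M s
  | inr E => {X : set (env M (eq_ctx E)) | exists x, X = eq_class x}
  end.

Fixpoint home_env (G : seq (sorts L)) :
    env eq_carrier (map inl G) -> env M G :=
  match G return env eq_carrier (map inl G) -> env M G with
  | [::] => fun _ => tt
  | s :: G' => fun x => (x.1, home_env x.2)
  end.

Definition eq_proj (E : def_equiv) (x : env M (eq_ctx E)) :
    eq_carrier (inr E) :=
  exist _ (eq_class x) (ex_intro _ x erefl).

Definition eq_fint (f : func eq_signature) :
    env eq_carrier (fdom f) -> eq_carrier (fcod f) :=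
  match f return env eq_carrier (@fdom eq_signature f) ->
                 eq_carrier (@fcod eq_signature f) with
  | inl f => fun x => fint (home_env x)
  | inr E => fun x => eq_proj (home_env x)
  end.

Definition eq_rint (r : rel eq_signature) (x : env eq_carrier (rdom r)) :
    Prop :=
  @rint L M r (home_env x).

Lemma env_inhabited (G : seq (sorts L)) : inhabited (env M G).
Proof.
elim: G => [|s G [x]]; first exact: (inhabits tt).
by have [a] := inh M s; exact: (inhabits (a, x)).
Qed.

Lemma eq_carrier_inhabited (s : sorts eq_signature) :
  inhabited (eq_carrier s).
Proof.
case: s => [s|E]; first exact: inh.
by have [x] := env_inhabited (eq_ctx E); exact: (inhabits (eq_proj x)).
Qed.

Definition eq_structure : structure eq_signature :=
  @Structure eq_signature eq_carrier eq_carrier_inhabited eq_fint eq_rint.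

Definition home (a : elt M) : elt eq_structure :=
  @mk_elt eq_signature eq_structure (inl (projT1 a)) (projT2 a).

End Imaginaries.

(* Main.v *)
(* Write [p] and [q] for the types of [a] and [b] over [A], and [m] for
   [m_A(a,b)].  Suppose that the type of [a] over [m b] implies a finite
   disjunction of formulas [phi_i] dividing over [m].  The realizations of
   [tp(a/Ab)] form a convex subset of those of [p], so by compactness some
   convex relatively [Ab]-definable [D_b] contains [a] and is covered by the
   [phi_i].  For [chi] in [q], simplicity of semiintervals makes
   [V_chi(x,y) : x and y lie in a common D_z with chi(z)] an equivalence
   relation on the realizations of [p].

   If, for some [chi], [D_b] contains a final (or initial) segment of the
   [V_chi]-class of [a], then by weak o-minimality so does some [phi_i]; that
   class has a canonical parameter in [m], so any finitely many conjugates of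
   [phi_i] over [m] have a common point and [phi_i] does not divide over [m].

   Otherwise [D_b] is strictly bounded on both sides inside the class of [a]
   modulo [x ~ y : x and y lie in a common D_z with z realizing q].  This is
   impossible: along a suitable cut of [q], the final segments on which
   [x] stays in [D_z] shrink as [x] moves away from [a] in either direction,
   which contradicts the transitivity of automorphisms on [p]. *)

Require Import Defs.
From HB Require Import structures.
From mathcomp Require Import all_boot.
From mathcomp Require Import boolp classical_sets functions cardinality filter.

Set Implicit Arguments.
Unset Strict Implicit.
Unset Printing Implicit Defensive.

Local Open Scope classical_set_scope.
Local Open Scope card_scope.

(** * Definable sets and automorphisms *)

(** The relation ~ is given only as the intersection of the [V_chi] with chi in q, so its classes
    have no evident canonical parameters. This is why dividing is refuted for classes of a single
    [V_chi], and why compactness passes to ~ only once every [V_chi] has failed to provide a segment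
    inside [D_b]. Simplicity of semiintervals applies to the set of all y above a with [V_chi(a,y)]:
    it is a semiinterval with minimum a, hence one half of a class of some relation in [E_p], and
    transitivity is inherited from that relation. No monotonicity ties the order on q to the sets
    [D_z]. What weak o-minimality of q gives is that membership of a fixed x in [D_z] becomes
    constant as z approaches a cut from one side, provided it recurs there. The cut has to be
    determined by the ~-class of a alone: every automorphism carrying one point of the class into
    the class then preserves it, even if it moves b. *)

Section Environments.
Variables (S : Type) (F : S -> Type).
Implicit Types G D : seq S.

Fixpoint env_take G D : env F (G ++ D) -> env F G :=
  match G return env F (G ++ D) -> env F G with
  | [::] => fun _ => tt
  | s :: G' => fun x => (x.1, env_take x.2)
  end.

Fixpoint env_drop G D : env F (G ++ D) -> env F D :=
  match G return env F (G ++ D) -> env F D with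
  | [::] => fun x => x
  | s :: G' => fun x => env_drop x.2
  end.

Lemma env_cat_take_drop G D (x : env F (G ++ D)) :
  env_cat (env_take x) (env_drop x) = x.
Proof. by elim: G x => [|s G IH] //= [u x] /=; rewrite IH. Qed.

Lemma env_take_cat G D (x : env F G) (y : env F D) :
  env_take (env_cat x y) = x.
Proof. by elim: G x => [|s G IH] /= => [[]|[u x]] //=; rewrite IH. Qed.

Lemma env_drop_cat G D (x : env F G) (y : env F D) :
  env_drop (env_cat x y) = y.
Proof. by elim: G x => [|s G IH] //= [u x]; rewrite IH. Qed.

Lemma env_in_sub (B B' : set {s & F s}) G (x : env F G) :
  B `<=` B' -> env_in B x -> env_in B' x.
Proof.
by move=> sB; elim: G x => [|s G IH] //= [u x] [Bu /IH]; split=> //; exact: sB.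
Qed.

Lemma env_in_cat (B : set {s & F s}) G D (x : env F G) (y : env F D) :
  env_in B x -> env_in B y -> env_in B (env_cat x y).
Proof. by elim: G x => [|s G IH] //= [u x] [Bu /IH Bx] /Bx. Qed.

Lemma env_in_lookup (B : set {s & F s}) G (x : env F G) s (v : var G s) :
  env_in B x -> B (existT F s (lookup v x)).
Proof. by elim: v x => [G' s'|G' s' t v IH] /= [u x] /= [Bu Bx] //; exact: IH. Qed.

Lemma lookup_map (f : forall s, F s -> F s) G (x : env F G) s (v : var G s) :
  lookup v (env_map f x) = f s (lookup v x).
Proof. by elim: v x => //= G' s' t v IH [u x] /=. Qed.

Lemma lookup_inj G (x y : env F G) :
  (forall s (v : var G s), lookup v x = lookup v y) -> x = y.
Proof.
elim: G x y => [|s G IH] /= => [[] []|[u x] [w y] H] //.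
have -> : u = w := H _ (VZ G s).
by rewrite (IH x y) // => s' v; exact: (H _ (VS s v)).
Qed.

Lemma env_map_cat (f : forall s, F s -> F s) G D (x : env F G) (y : env F D) :
  env_map f (env_cat x y) = env_cat (env_map f x) (env_map f y).
Proof. by elim: G x => //= s G IH [u x] /=; rewrite IH. Qed.

Lemma env_map_fixed (f : forall s, F s -> F s) (B : set {s & F s}) G
    (x : env F G) :
  (forall e, B e -> f _ (projT2 e) = projT2 e) -> env_in B x ->
  env_map f x = x.
Proof.
move=> fB; elim: G x => [[]|s G IH [u x]] //= [Bu Bx].
by rewrite IH // (fB _ Bu).
Qed.

Fixpoint env_elts G : env F G -> set {s & F s} :=
  match G return env F G -> set {s & F s} with
  | [::] => fun _ => set0
  | s :: G' => fun x => [set existT F s x.1] `|` env_elts x.2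
  end.

Lemma finite_env_elts G (x : env F G) : finite_set (env_elts x).
Proof.
elim: G x => [|s G IH] x /=; first exact: finite_set0.
by rewrite finite_setU; split=> //; exact: finite_set1.
Qed.

Lemma env_in_elts G (x : env F G) : env_in (env_elts x) x.
Proof.
elim: G x => [|s G IH] //= [u x] /=; split; first by left.
by apply: env_in_sub (IH x) => e; right.
Qed.

Lemma env_eltsP G (x : env F G) e :
  env_elts x e -> exists v : var G (projT1 e), lookup v x = projT2 e.
Proof.
elim: G x => [|s G IH] //= [u x] /= [->|/IH[v vE]]; first by exists (VZ _ _).
by exists (VS _ v).
Qed.

Lemma env_in_eltsP (B : set {s & F s}) G (x : env F G) :
  env_in B x <-> env_elts x `<=` B.
Proof.
split=> [Bx e /env_eltsP[v]|xB]; last exact: env_in_sub (env_in_elts x).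
by case: e v => s y /= v <-; exact: env_in_lookup.
Qed.

End Environments.

Scheme term_terms_ind := Induction for term Sort Prop
  with terms_term_ind := Induction for terms Sort Prop.
Combined Scheme term_mutind from term_terms_ind, terms_term_ind.

Section Definability.
Variables (L : signature) (M : structure L).
Implicit Types G D : seq (sorts L).

(** Maps between tuples are tracked through the terms that compute them, so that substitution,
    weakening and renaming in formulas all become composition, by [definable0_comp]. *)
Definition term_fun D s (f : env M D -> M s) : Prop :=
  exists t : term D s, forall x, eval t x = f x.

Fixpoint term_map D G : (env M D -> env M G) -> Prop :=
  match G return (env M D -> env M G) -> Prop with
  | [::] => fun _ => True
  | s :: G' => fun F => term_fun (fun x => (F x).1) /\
                        term_map (fun x => (F x).2)
  end.

Lemma term_map_ext D G (F F' : env M D -> env M G) :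
  (forall x, F x = F' x) -> term_map F -> term_map F'.
Proof. by move=> /funext->. Qed.

Lemma term_map_lookup D G (F : env M D -> env M G) s (v : var G s) :
  term_map F -> term_fun (fun x => lookup v (F x)).
Proof. by elim: v F => [G' s'|G' s' t v IH] F /= [F1 F2] //; exact: IH. Qed.

Lemma term_mapW D G (F : env M D -> env M G) :
  (forall s (v : var G s), term_fun (fun x => lookup v (F x))) -> term_map F.
Proof.
elim: G F => //= s G IH F H; split; first exact: (H _ (VZ G s)).
by apply: IH => s' v; exact: (H _ (VS s v)).
Qed.

Lemma term_fun_lookup D s (v : var D s) : term_fun (fun x => lookup v x).
Proof. by exists (Var v). Qed.

Lemma term_map_id D : term_map (fun x : env M D => x).
Proof. by apply: term_mapW => s v; exact: term_fun_lookup. Qed.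

Lemma term_map_snd D s : term_map (fun x : env M (s :: D) => x.2).
Proof. by case: (term_map_id (s :: D)). Qed.

Lemma term_map_terms D G (F : env M D -> env M G) :
  term_map F -> exists ts : terms D G, forall x, evals ts x = F x.
Proof.
elim: G F => [|s G IH] F /=.
  by move=> _; exists (TNil _) => x; case: (F x).
move=> [[t tE] /IH [ts tsE]]; exists (TCons t ts) => x /=.
by rewrite tE tsE; case: (F x).
Qed.

Lemma term_subst D G (F : env M D -> env M G) : term_map F ->
  (forall s (t : term G s), term_fun (fun x => eval t (F x))) /\
  (forall D' (ts : terms G D'),
     exists us : terms D D', forall x, evals us x = evals ts (F x)).
Proof.
move=> hF; apply: term_mutind => [s v|f ts [us usE]||s D' t [u uE] ts [us usE]].
- exact: term_map_lookup.
- by exists (App us) => x /=; rewrite usE.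
- by exists (TNil _).
- by exists (TCons u us) => x /=; rewrite uE usE.
Qed.

Lemma term_map_comp D G G' (F' : env M G -> env M G') (F : env M D -> env M G) :
  term_map F' -> term_map F -> term_map (fun x => F' (F x)).
Proof.
move=> hF' hF; apply: term_mapW => s v.
have [t tE] := term_map_lookup v hF'.
have [u uE] := (term_subst hF).1 _ t.
by exists u => x; rewrite uE tE.
Qed.

Lemma term_map_cat D G G' (F : env M D -> env M G) (F' : env M D -> env M G') :
  term_map F -> term_map F' -> term_map (fun x => env_cat (F x) (F' x)).
Proof. by elim: G F => //= s G IH F [F1 F2] hF'; split=> //; exact: IH. Qed.

Lemma term_map_take G D : term_map (fun x : env M (G ++ D) => env_take x).
Proof.
elim: G => //= s G IH; split; first exact: (term_fun_lookup (VZ _ _)).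
exact: (term_map_comp IH (term_map_snd _ _)).
Qed.

Lemma term_map_drop G D : term_map (fun x : env M (G ++ D) => env_drop x).
Proof.
elim: G => [|s G IH] /=; first exact: term_map_id.
exact: (term_map_comp IH (term_map_snd _ _)).
Qed.

Definition definable0 G (P : env M G -> Prop) : Prop :=
  exists phi : formula G, forall x, sat phi x <-> P x.

Lemma definable0_ext G (P Q : env M G -> Prop) :
  (forall x, P x <-> Q x) -> definable0 P -> definable0 Q.
Proof. by move=> PQ [phi phiE]; exists phi => x; rewrite phiE. Qed.

Lemma definable0_sat G (phi : formula G) : definable0 (sat phi).
Proof. by exists phi. Qed.

Lemma definable0_comp D G (F : env M D -> env M G) (P : env M G -> Prop) :
  term_map F -> definable0 P -> definable0 (fun x => P (F x)).
Proof.
move=> hF [phi phiE].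
suff [psi psiE] : definable0 (fun x => sat phi (F x)).
  by exists psi => x; rewrite psiE phiE.
elim: phi D F hF {P phiE} => {G} [G s t u|G r ts|G|G p IHp q IHq|G s p IH] D F hF.
- have [t' t'E] := (term_subst hF).1 _ t; have [u' u'E] := (term_subst hF).1 _ u.
  by exists (FEq t' u') => x /=; rewrite t'E u'E.
- have [us usE] := (term_subst hF).2 _ ts.
  by exists (FRel us) => x /=; rewrite usE.
- by exists (FFalse _).
- have [p' p'E] := IHp _ _ hF; have [q' q'E] := IHq _ _ hF.
  by exists (FImp p' q') => x /=; rewrite p'E q'E.
- have hF' : term_map (fun z : env M (s :: D) => (z.1, F z.2) : env M (s :: G)).
    split; first exact: (term_fun_lookup (VZ _ _)).
    exact: (term_map_comp hF (term_map_snd _ _)).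
  have [p' p'E] := IH _ _ hF'.
  exists (FAll p') => x /=; split=> H a.
    exact: (p'E (a, x)).1 (H a).
  exact: (p'E (a, x)).2 (H a).
Qed.

Lemma definable0_imp G (P Q : env M G -> Prop) :
  definable0 P -> definable0 Q -> definable0 (fun x => P x -> Q x).
Proof. by move=> [p pE] [q qE]; exists (FImp p q) => x /=; rewrite pE qE. Qed.

Lemma definable0_False G : definable0 (fun _ : env M G => False).
Proof. by exists (FFalse _). Qed.

Lemma definable0_eq G s (f g : env M G -> M s) :
  term_fun f -> term_fun g -> definable0 (fun x => f x = g x).
Proof. by move=> [t tE] [u uE]; exists (FEq t u) => x /=; rewrite tE uE. Qed.

Lemma definable0_and G (P Q : env M G -> Prop) :
  definable0 P -> definable0 Q -> definable0 (fun x => P x /\ Q x).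
Proof.
move=> dP dQ; have dF := definable0_False G.
apply: definable0_ext (definable0_imp (definable0_imp dP (definable0_imp dQ dF)) dF).
move=> x; split=> [H|[Px Qx] H]; last exact: H.
by split; apply: contrapT => ?; apply: H.
Qed.

Lemma definable0_eq_env D G (F F' : env M D -> env M G) :
  term_map F -> term_map F' -> definable0 (fun x => F x = F' x).
Proof.
elim: G F F' => [|s G IH] F F' /=.
  move=> _ _; apply: (@definable0_ext _ (fun _ => False -> False)).
    by move=> x; split=> // _; case: (F x) (F' x) => [] [].
  by apply: definable0_imp; exact: definable0_False.
move=> [F1 F2] [F1' F2'].
apply: definable0_ext (definable0_and (definable0_eq F1 F1') (IH _ _ F2 F2')) => x.
by case: (F x) (F' x) => [? ?] [? ?] /=; split=> [[-> ->]|[-> ->]].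
Qed.

Lemma definable0_all G s (P : env M (s :: G) -> Prop) :
  definable0 P -> definable0 (fun x : env M G => forall a : M s, P (a, x)).
Proof.
by move=> [p pE]; exists (FAll p) => x /=; split=> H a; apply/pE; exact: H.
Qed.

Lemma definable0_all_env D G (P : env M (D ++ G) -> Prop) :
  definable0 P ->
  definable0 (fun x : env M G => forall z : env M D, P (env_cat z x)).
Proof.
elim: D P => [|s D IH] /= P dP.
  by apply: definable0_ext dP => x; split=> [H []|H] //; exact: (H tt).
have := IH _ (definable0_all dP); apply: definable0_ext => x.
by split=> [H [a z]|H z a] /=; [exact: H|exact: (H (a, z))].
Qed.

Definition definable (B : set (elt M)) G (P : env M G -> Prop) : Prop :=
  exists D (phi : formula (G ++ D)) (v : env M D),
    env_in B v /\ forall x, sat phi (env_cat x v) <-> P x.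

Lemma definable_ext (B : set (elt M)) G (P Q : env M G -> Prop) :
  (forall x, P x <-> Q x) -> definable B P -> definable B Q.
Proof.
by move=> PQ [D [phi [v [Bv vE]]]]; exists D, phi, v; split=> // x; rewrite vE.
Qed.

Lemma definable_sub (B B' : set (elt M)) G (P : env M G -> Prop) :
  B `<=` B' -> definable B P -> definable B' P.
Proof.
move=> sB [D [phi [v [Bv vE]]]]; exists D, phi, v; split=> //.
exact: env_in_sub Bv.
Qed.

Lemma definable_pformula (B : set (elt M)) G (P : env M G -> Prop) :
  definable B P <->
  exists phi : pformula M G, Defs.over B phi /\ forall x, psat phi x <-> P x.
Proof.
split=> [[D [phi [v [Bv vE]]]]|[[D phi v] [Bv vE]]].
  by exists (PFormula phi v).
by exists D, phi, v.
Qed.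

Lemma definable_psat (B : set (elt M)) G (phi : pformula M G) :
  Defs.over B phi -> definable B (psat phi).
Proof. by move=> Bphi; apply/definable_pformula; exists phi. Qed.

Lemma definable_mk (B : set (elt M)) G D (R : env M (G ++ D) -> Prop)
    (v : env M D) :
  env_in B v -> definable0 R -> definable B (fun x => R (env_cat x v)).
Proof. by move=> Bv [phi phiE]; exists D, phi, v. Qed.

Lemma definable0W (B : set (elt M)) G (P : env M G -> Prop) :
  definable0 P -> definable B P.
Proof.
(* The contexts [G] and [G ++ [::]] are not convertible, and [env_take] bridges the difference. *)
move=> dP; apply: (@definable_ext _ _ (fun x => P (env_take (env_cat x (tt : env M [::]))))).
  by move=> x; rewrite env_take_cat.
apply: (@definable_mk _ _ [::] (fun y => P (env_take y)) tt) => //.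
exact: (definable0_comp (term_map_take _ _) dP).
Qed.

Lemma definable_imp (B : set (elt M)) G (P Q : env M G -> Prop) :
  definable B P -> definable B Q -> definable B (fun x => P x -> Q x).
Proof.
move=> [D [p [v [Bv vE]]]] [D' [q [w [Bw wE]]]].
set R := fun y : env M (G ++ (D ++ D')) =>
  sat p (env_cat (env_take y) (env_take (env_drop y))) ->
  sat q (env_cat (env_take y) (env_drop (env_drop y))).
apply: (@definable_ext _ _ (fun x => R (env_cat x (env_cat v w)))).
  by move=> x; rewrite /R !env_take_cat !env_drop_cat env_take_cat vE wE.
apply: definable_mk; first exact: env_in_cat.
apply: definable0_imp;
  (apply: (definable0_comp (P := sat _)); last exact: definable0_sat);
  (apply: term_map_cat; first exact: term_map_take).
- exact: (term_map_comp (term_map_take _ _) (term_map_drop _ _)).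
- exact: (term_map_comp (term_map_drop _ _) (term_map_drop _ _)).
Qed.

Lemma definable_False (B : set (elt M)) G : definable B (fun _ : env M G => False).
Proof. exact/definable0W/definable0_False. Qed.

Lemma definable_not (B : set (elt M)) G (P : env M G -> Prop) :
  definable B P -> definable B (fun x => ~ P x).
Proof. by move=> dP; apply: definable_imp dP _; exact: definable_False. Qed.

Lemma definable_and (B : set (elt M)) G (P Q : env M G -> Prop) :
  definable B P -> definable B Q -> definable B (fun x => P x /\ Q x).
Proof.
move=> dP dQ; apply: definable_ext (definable_not (definable_imp dP (definable_not dQ))).
move=> x; split=> [H|[Px Qx] H]; last exact: H.
by split; apply: contrapT => ?; apply: H.
Qed.

Lemma definable_or (B : set (elt M)) G (P Q : env M G -> Prop) :
  definable B P -> definable B Q -> definable B (fun x => P x \/ Q x).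
Proof.
move=> dP dQ; apply: definable_ext (definable_imp (definable_not dP) dQ) => x.
split=> [H|[]] //; case: (pselect (P x)) => [|/H]; by [left|right].
Qed.

Lemma definable_iff (B : set (elt M)) G (P Q : env M G -> Prop) :
  definable B P -> definable B Q -> definable B (fun x => P x <-> Q x).
Proof. by move=> dP dQ; apply: definable_and; exact: definable_imp. Qed.

Lemma definable_all (B : set (elt M)) G s (P : env M (s :: G) -> Prop) :
  definable B P -> definable B (fun x : env M G => forall a : M s, P (a, x)).
Proof.
move=> [D [p [v [Bv vE]]]]; exists D, (@FAll _ (G ++ D) s p), v; split=> // x /=.
by split=> H a; [exact: (vE (a, x)).1 (H a)|exact: (vE (a, x)).2 (H a)].
Qed.

Lemma definable_ex (B : set (elt M)) G s (P : env M (s :: G) -> Prop) :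
  definable B P -> definable B (fun x : env M G => exists a : M s, P (a, x)).
Proof.
move=> dP; apply: definable_ext (definable_not (definable_all (definable_not dP))).
by move=> x; rewrite -existsNE; split=> [[a /contrapT]|[a Pa]]; exists a.
Qed.

(* A coordinate of a [param_map] is a variable or an element of [B]. *)
Definition param_fun (B : set (elt M)) D s (f : env M D -> M s) : Prop :=
  (exists v : var D s, forall x, f x = lookup v x) \/
  (exists c, B (mk_elt c) /\ forall x, f x = c).

Fixpoint param_map (B : set (elt M)) D G : (env M D -> env M G) -> Prop :=
  match G return (env M D -> env M G) -> Prop with
  | [::] => fun _ => True
  | s :: G' => fun F => param_fun B (fun x => (F x).1) /\
                        param_map B (fun x => (F x).2)
  end.

Lemma param_map_term_map (B : set (elt M)) D G (F : env M D -> env M G) :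
  param_map B F -> exists D' (F' : env M (D ++ D') -> env M G) (w : env M D'),
    [/\ term_map F', env_in B w & forall x, F x = F' (env_cat x w)].
Proof.
elim: G F => [|s G IH] F /=.
  move=> _; exists [::], (fun _ => tt), tt; split=> // x; by case: (F x).
move=> [F1 /IH [D' [F' [w [tF' Bw FE]]]]].
case: F1 => [[v vE]|[c [Bc cE]]].
  exists D', (fun y => (lookup v (env_take y), F' y)), w; split=> //=.
    split=> //; exact: (term_map_lookup v (term_map_take D D')).
  by move=> x; rewrite env_take_cat -vE -FE; case: (F x).
pose dr (y : env M (D ++ s :: D')) : env M (s :: D') := env_drop y.
exists (s :: D'), (fun y => ((dr y).1, F' (env_cat (env_take y) (dr y).2))).
exists (c, w); split=> //=.
  split.
    exact: (term_map_lookup (VZ _ _) (term_map_drop D (s :: D'))).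
  apply: (term_map_comp tF'); apply: term_map_cat; first exact: term_map_take.
  exact: (term_map_comp (term_map_snd _ _) (term_map_drop D (s :: D'))).
by move=> x; rewrite /dr env_take_cat env_drop_cat /= -FE -(cE x); case: (F x).
Qed.

Lemma param_map_lookup (B : set (elt M)) D G (F : env M D -> env M G) s
    (v : var G s) :
  param_map B F -> param_fun B (fun x => lookup v (F x)).
Proof. by elim: v F => [G' s'|G' s' t v IH] F /= [F1 F2] //; exact: IH. Qed.

Lemma param_mapW (B : set (elt M)) D G (F : env M D -> env M G) :
  (forall s (v : var G s), param_fun B (fun x => lookup v (F x))) ->
  param_map B F.
Proof.
elim: G F => //= s G IH F H; split; first exact: (H _ (VZ G s)).
by apply: IH => s' v; exact: (H _ (VS s v)).
Qed.

Lemma param_fun_lookup (B : set (elt M)) D s (v : var D s) :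
  param_fun B (fun x => lookup v x).
Proof. by left; exists v. Qed.

Lemma param_fun_const (B : set (elt M)) D s (c : M s) :
  B (mk_elt c) -> param_fun B (fun _ : env M D => c).
Proof. by right; exists c. Qed.

Lemma param_map_id (B : set (elt M)) D : param_map B (fun x : env M D => x).
Proof. by apply: param_mapW => s v; exact: param_fun_lookup. Qed.

Lemma param_map_snd (B : set (elt M)) D s :
  param_map B (fun x : env M (s :: D) => x.2).
Proof. by case: (param_map_id B (s :: D)). Qed.

Lemma param_fun_comp (B : set (elt M)) D G s (f : env M G -> M s)
    (F : env M D -> env M G) :
  param_fun B f -> param_map B F -> param_fun B (fun x => f (F x)).
Proof.
move=> [[v vE]|[c [Bc cE]]] hF; last by right; exists c.
have [[w wE]|[c [Bc cE]]] := param_map_lookup v hF.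
  by left; exists w => x; rewrite vE wE.
by right; exists c; split=> // x; rewrite vE cE.
Qed.

Lemma param_map_comp (B : set (elt M)) D G G' (F' : env M G -> env M G')
    (F : env M D -> env M G) :
  param_map B F' -> param_map B F -> param_map B (fun x => F' (F x)).
Proof.
move=> hF' hF; apply: param_mapW => s v.
exact: (param_fun_comp (param_map_lookup v hF') hF).
Qed.

Lemma param_map_take (B : set (elt M)) G D :
  param_map B (fun x : env M (G ++ D) => env_take x).
Proof.
elim: G => //= s G IH; split; first exact: (param_fun_lookup _ (VZ _ _)).
exact: (param_map_comp IH (param_map_snd _ _ _)).
Qed.

Lemma param_map_drop (B : set (elt M)) G D :
  param_map B (fun x : env M (G ++ D) => env_drop x).
Proof.
elim: G => [|s G IH] /=; first exact: param_map_id.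
exact: (param_map_comp IH (param_map_snd _ _ _)).
Qed.

Lemma definable_ex_env (B : set (elt M)) D G (P : env M (D ++ G) -> Prop) :
  definable B P ->
  definable B (fun x : env M G => exists z : env M D, P (env_cat z x)).
Proof.
elim: D P => [|s D IH] /= P dP.
  by apply: definable_ext dP => x; split=> [H|[]] //; exists tt.
have := IH _ (definable_ex dP); apply: definable_ext => x.
by split=> [[z [a Pa]]|[[a z] Pa]]; [exists (a, z)|exists z, a].
Qed.

Lemma definable_comp (B : set (elt M)) D G (F : env M D -> env M G)
    (P : env M G -> Prop) :
  param_map B F -> definable B P -> definable B (fun x => P (F x)).
Proof.
move=> /param_map_term_map[D' [F' [w [tF' Bw FE]]]] [E [phi [v [Bv vE]]]].
set R := fun y : env M (D ++ (D' ++ E)) =>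
  sat phi (env_cat (F' (env_cat (env_take y) (env_take (env_drop y))))
                   (env_drop (env_drop y))).
apply: (@definable_ext _ _ (fun x => R (env_cat x (env_cat w v)))).
  by move=> x; rewrite /R !env_take_cat !env_drop_cat env_take_cat vE FE.
apply: definable_mk; first exact: env_in_cat.
apply: (definable0_comp (P := sat _)); last exact: definable0_sat.
apply: term_map_cat; last exact: (term_map_comp (term_map_drop _ _) (term_map_drop _ _)).
apply: (term_map_comp tF'); apply: term_map_cat; first exact: term_map_take.
exact: (term_map_comp (term_map_take _ _) (term_map_drop _ _)).
Qed.

Lemma definable_eq (B : set (elt M)) D s (f g : env M D -> M s) :
  param_fun B f -> param_fun B g -> definable B (fun x => f x = g x).
Proof.
move=> hf hg; pose F x : env M [:: s; s] := (f x, (g x, tt)).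
apply: (definable_comp (F := F) (P := fun y => y.1 = y.2.1)) => //.
apply/definable0W/definable0_eq; first exact: (term_fun_lookup (VZ _ _)).
exact: (term_fun_lookup (VS _ (VZ _ _))).
Qed.

End Definability.

Arguments term_map_id {L M} D.
Arguments term_map_snd {L M} D s.
Arguments term_map_take {L M} G D.
Arguments term_map_drop {L M} G D.
Arguments param_map_id {L M} B D.
Arguments param_map_snd {L M} B D s.
Arguments param_map_take {L M} B G D.
Arguments param_map_drop {L M} B G D.

Section Automorphisms.
Variables (L : signature) (M : structure L) (g : forall s, M s -> M s).
Hypothesis ag : automorphism g.
Implicit Types G D : seq (sorts L).

Lemma automorphism_surj s (y : M s) : exists x, g x = y.
Proof. by have [/(_ s)[g' gK g'K] _ _] := ag; exists (g' y). Qed.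

Lemma automorphism_inj s : injective (@g s).
Proof. by have [/(_ s)/bij_inj] := ag. Qed.

Lemma automorphism_eval G :
  (forall s (t : term G s) (x : env M G), g (eval t x) = eval t (env_map g x)) /\
  (forall D (ts : terms G D) (x : env M G),
     env_map g (evals ts x) = evals ts (env_map g x)).
Proof.
apply: term_mutind => [s v x|f ts IH x|x|s D t IHt ts IHts x] //=.
- by rewrite lookup_map.
- by have [_ gf _] := ag; rewrite gf IH.
- by rewrite IHt IHts.
Qed.

Lemma automorphism_sat G (phi : formula G) (x : env M G) :
  sat phi x <-> sat phi (env_map g x).
Proof.
elim: phi x => {G} [G s t u|G r ts|G|G p IHp q IHq|G s p IH] x /=.
- rewrite -!(automorphism_eval G).1; split=> [->|] //; exact: automorphism_inj.
- by have [_ _ gr] := ag; rewrite gr (automorphism_eval G).2.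
- by [].
- by rewrite IHp IHq.
- split=> H a; last by apply/IH; exact: H.
  by have [b <-] := automorphism_surj a; have /IH := H b.
Qed.

Lemma automorphism_psat G D (phi : formula (G ++ D)) (v : env M D) x :
  psat (PFormula phi v) x <-> psat (PFormula phi (env_map g v)) (env_map g x).
Proof. by rewrite /psat /= -env_map_cat; exact: automorphism_sat. Qed.

Lemma automorphism_definable (B : set (elt M)) G (P : env M G -> Prop) x :
  (forall e, B e -> g (projT2 e) = projT2 e) -> definable B P ->
  P x <-> P (env_map g x).
Proof.
move=> gB [D [phi [v [Bv vE]]]]; rewrite -!vE.
by rewrite (automorphism_sat phi) env_map_cat (env_map_fixed gB Bv).
Qed.

End Automorphisms.

(** * Compactness and homogeneity *)

Lemma card_le_fun (K U : Type) (X : set U) :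
  inhabited U -> [set: K] #<= X <-> exists2 f : K -> U, injective f & forall k, X (f k).
Proof.
move=> [c]; split.
  pose U' : pointedType := HB.pack U (gen_eqMixin U) (gen_choiceMixin U) (isPointed.Build U c).
  move=> /(@pcard_leP K U')[f]; exists f; last by move=> k; exact: funS.
  by move=> x y; apply: inj; rewrite inE.
move=> [f fi fX]. 
have fK : f @` [set: K] #= [set: K].
  by apply: (@inj_card_eq _ _ [set: K]) => x y _ _; exact: fi.
rewrite -(card_le_eql fK); apply: subset_card_le => _ [k _ <-]; exact: fX.
Qed.

Lemma card_le_setU1 (K U : Type) (X : set U) c :
  infinite_set [set: K] -> [set: K] #<= X `|` [set c] -> [set: K] #<= X.
Proof.
move=> Kinf; have Uinh := inhabits c.
move=> /card_le_fun -/(_ Uinh)[f fi fX]; apply/card_le_fun=> //.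
have [[k0 fk0]|nc] := pselect (exists k, f k = c); last first.
  by exists f => // k; case: (fX k) => // fk; case: nc; exists k.
have : infinite_set ([set: K] `\ k0) by apply: infinite_setD => //; exact: finite_set1.
move=> /infiniteP /card_le_fun -/(_ (inhabits k0)) [u ui uk0].
pose v n := if n is m.+1 then u m else k0.
have vi : injective v.
  move=> [|n] [|m] //= E; last by rewrite (ui _ _ E).
    by case: (uk0 m) => _ []; rewrite -E.
  by case: (uk0 n) => _ [].
(* Hilbert's hotel: shift along the sequence [v] to avoid [v 0 = k0]. *)
pose sh k := if pselect (exists n, k = v n) is left e then v (projT1 (cid e)).+1
             else k.
have shv n : sh (v n) = v n.+1.
  rewrite /sh; case: pselect => [e|[]]; last by exists n.
  by case: cid => m /= /vi->.
have shN k : ~ (exists n, k = v n) -> sh k = k.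
  by rewrite /sh; case: pselect.
exists (f \o sh).
  apply: inj_comp => // x y.
  have [[n ->]|nx] := pselect (exists n, x = v n);
    have [[m ->]|ny] := pselect (exists n, y = v n); rewrite ?shv ?shN //.
  - by move=> /vi[->].
  - by move=> E; case: ny; exists n.+1.
  - by move=> E; case: nx; exists m.+1.
move=> k /=; have shk : sh k <> k0.
  have [[n ->]|nk] := pselect (exists n, k = v n).
    by rewrite shv => /(vi n.+1 0).
  by rewrite shN // => E; case: nk; exists 0.
by case: (fX (sh k)) => // E; case: shk; apply: fi; rewrite fk0.
Qed.

Lemma card_le_setU_finite (K U : Type) (X F : set U) :
  infinite_set [set: K] -> finite_set F -> [set: K] #<= X `|` F ->
  [set: K] #<= X.
Proof.
move=> Kinf; have -> := finite_seqP (T := {classic U}) F => -[s ->].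
elim: s => [|c s IH]; first by rewrite set_nil setU0.
move=> KX; apply: IH; apply: (card_le_setU1 (c := c)) => //.
apply: card_le_trans KX (subset_card_le _) => x [Xx|/=]; first by left; left.
by rewrite in_cons => /orP[/eqP->|sx]; [right|left; right].
Qed.

Lemma small_setU_finite (K U : Type) (B F : set U) :
  infinite_set [set: K] -> finite_set F -> small K B -> small K (B `|` F).
Proof. by move=> Kinf Ffin sB /(card_le_setU_finite Kinf Ffin)/sB. Qed.

Section Compactness.
Variables (L : signature) (M : structure L) (K : Type).
Hypotheses (Kinf : infinite_set [set: K]) (Msat : saturated M K).

(** Extend [F] to an ultrafilter: the formulas over [B] whose solution sets belong to it form a
    complete type over [B], which saturation realizes. *)
Lemma saturated_1type (B : set (elt M)) s (F : set (set (env M [:: s]))) :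
  small K B -> ProperFilter F ->
  exists x, forall P : set (env M [:: s]), definable B P -> F P -> P x.
Proof.
move=> sB pF; have [U [uU FU]] := ultraFilterLemma pF.
have pU : ProperFilter U by exact: ultra_proper.
have fU : Filter U by exact: filter_filter.
pose p : set (pformula M [:: s]) := [set phi | Defs.over B phi /\ U (psat phi)].
have [x xp] : exists x, realizes p x.
  apply: (Msat sB); split=> [phi []|n phi pphi|phi Bphi] //.
    suff : U (fun x => forall i, psat (phi i) x) by move/filter_ex.
    elim: n phi pphi => [|n IH] phi pphi.
      by apply: (@filterS _ U fU setT) => [x _ [] //|]; exact: (@filterT _ U).
    have UI := IH _ (fun i => pphi (lift ord0 i)).
    apply: (@filterS _ U fU) (@filterI _ U fU _ _ (pphi ord0).2 UI) => x [H0 Hs] i.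
    by case: (unliftP ord0 i) => [j ->|->]; [exact: Hs|].
  by have [?|?] := in_ultra_setVsetC (psat phi) uU; [left|right].
exists x => P /definable_pformula[phi [Bphi phiE]] FP; apply/phiE; apply: xp.
by split=> //; apply: (@filterS _ U fU) (FU _ FP) => y /phiE.
Qed.

Definition directed_family T I (X : I -> T -> Prop) : Prop :=
  forall i j, exists k, forall x, X k x -> X i x /\ X j x.

(** Saturation speaks of one variable. The first coordinate is therefore chosen in all the
    projections [X1 i] and joins the parameters, which remain small, before the next one is
    chosen. *)
Lemma saturated_compact D (B : set (elt M)) I (X : I -> env M D -> Prop) :
  small K B -> inhabited I -> (forall i, definable B (X i)) ->
  directed_family X -> (forall i, exists x, X i x) ->
  exists x, forall i, X i x.
Proof.
elim: D B X => [|s D IH] B X sB [i0] dX dirX X0.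
  by exists tt => i; have [[]] := X0 i.
pose X1 i : set (env M [:: s]) := fun y => exists z, X i (y.1, z).
have dX1 i : definable B (X1 i).
  pose F (w : env M (D ++ [:: s])) : env M (s :: D) :=
    ((env_drop w : env M [:: s]).1, env_take w).
  have /definable_ex_env : definable B (fun w => X i (F w)).
    apply: definable_comp (dX i); split; last exact: param_map_take.
    exact: (param_map_lookup (VZ _ _) (param_map_drop _ _ _)).
  apply: definable_ext => y; rewrite /F /X1.
  by split=> -[z Xz]; exists z; move: Xz; rewrite env_drop_cat env_take_cat.
have fF : Filter (filter_from setT X1).
  apply: filter_from_filter; first by exists i0.
  move=> i j _ _; have [k kij] := dirX i j; exists k => // y [z /kij[? ?]].
  by split; exists z.
have pF : ProperFilter (filter_from setT X1).
  by apply: filter_from_proper => i _; have [[y z] Xyz] := X0 i; exists (y, tt), z.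
have [[a []] aP] := saturated_1type sB pF.
have Xa i : exists z, X i (a, z) by apply: (aP (X1 i)) => //; exists i.
pose B' := B `|` [set mk_elt a].
have sB' : small K B' by apply: small_setU_finite => //; exact: finite_set1.
have [||z Xz] := IH B' (fun i z => X i (a, z)) sB' (inhabits i0) _ _ Xa.
- move=> i; apply: (definable_comp (F := fun z : env M D => (a, z) : env M (s :: D))).
    by split; [apply: param_fun_const; right|exact: param_map_id].
  by apply: definable_sub (dX i); left.
- by move=> i j; have [k kij] := dirX i j; exists k => z /kij.
- by exists (a, z).
Qed.

End Compactness.

Section Homogeneity.
Variables (L : signature) (M : structure L) (K : Type).
Hypotheses (Kinf : infinite_set [set: K]) (Mhom : strongly_homogeneous M K).

(** A tuple from [B] and [c] is a parameter map applied to [c]. Elementarity of [g] thus reduces to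
    the comparison of [c] and [d] on predicates definable over [B]. *)
Lemma param_map_env_in (B : set (elt M)) G (c d : env M G)
    (g : forall s, M s -> M s) :
  (forall s (v : var G s), g s (lookup v c) = lookup v d) ->
  (forall e, B e -> g _ (projT2 e) = projT2 e) ->
  forall D (x : env M D), env_in (B `|` env_elts c) x ->
  exists F : env M G -> env M D,
    [/\ param_map B F, F c = x & F d = env_map g x].
Proof.
move=> gc gB; elim=> [|s D IH]; first by case; exists (fun _ => tt).
move=> [u x] /= [Bu /IH[F [pF Fc Fd]]].
have [f [pf fc fd]] : exists f : env M G -> M s,
    [/\ param_fun B f, f c = u & f d = g s u].
  case: Bu => [Bu|/env_eltsP/=[v vE]].
    exists (fun _ => u); split=> //; first exact: param_fun_const.
    by rewrite (gB _ Bu).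
  exists (fun y => lookup v y); split=> //; first exact: param_fun_lookup.
  by rewrite -vE gc.
by exists (fun y => (f y, F y)); split=> //=; rewrite ?fc ?fd ?Fc ?Fd.
Qed.

Lemma homogeneous_env (B : set (elt M)) G (c d : env M G) :
  small K B ->
  (forall P : env M G -> Prop, definable B P -> P c -> P d) ->
  exists h : forall s, M s -> M s,
    [/\ automorphism h, forall e, B e -> h _ (projT2 e) = projT2 e &
        env_map h c = d].
Proof.
move=> sB cd.
(* An element may occur at several positions of [c], or also in [B]. Equations between coordinates
   and with elements of [B] are definable over [B], hence pass from [c] to [d], and the choice of a
   position is harmless. *)
pose g s (x : M s) : M s :=
  if pselect (exists v : var G s, lookup v c = x) is left e
  then lookup (projT1 (cid e)) d else x.
have gc s (v : var G s) : g s (lookup v c) = lookup v d.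
  rewrite /g; case: pselect => [e|[]]; last by exists v.
  case: cid => w /= wE.
  apply: (cd (fun y => lookup w y = lookup v y)) => //.
  by apply: definable_eq; exact: param_fun_lookup.
have gB e : B e -> g _ (projT2 e) = projT2 e.
  case: e => s x Bx /=; rewrite /g; case: pselect => // e.
  case: cid => w /= wE; apply: (cd (fun y => lookup w y = x)) => //.
  by apply: definable_eq; [exact: param_fun_lookup|exact: param_fun_const].
have gelem : elementary_on (B `|` env_elts c) g.
  move=> D phi x /(param_map_env_in gc gB)[F [pF <- <-]].
  have dP : definable B (fun y => sat phi (F y)).
    by apply: (definable_comp pF); apply/definable0W/definable0_sat.
  split; first exact: (cd _ dP).
  by apply: contraPP; exact: (cd _ (definable_not dP)).
have sBc : small K (B `|` env_elts c).
  by apply: small_setU_finite => //; exact: finite_env_elts.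
have [h ah hg] := Mhom sBc gelem.
exists h; split=> //.
  by move=> e Be; rewrite hg ?gB //; left; case: (e) Be.
apply: lookup_inj => s v; rewrite lookup_map hg ?gc //.
by right; exact: (env_in_lookup _ (env_in_elts c)).
Qed.

End Homogeneity.

(** * Imaginaries *)

Section Representatives.
Variables (L : signature) (C : structure L).
Let Q := eq_signature C.
Let Ceq : structure Q := eq_structure C.
Implicit Types G D : seq (sorts Q).

(** Every imaginary is the image of a tuple from the home sorts. Pulling predicates back to such
    representatives reduces compactness and homogeneity of [Ceq] to those of [C]. *)
Definition home_ctx (s : sorts Q) : seq (sorts L) :=
  match s with inl s => [:: s] | inr E => eq_ctx E end.

Fixpoint flat_ctx G : seq (sorts L) :=
  if G is s :: G' then home_ctx s ++ flat_ctx G' else [::].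

Definition of_rep (s : sorts Q) : env C (home_ctx s) -> Ceq s :=
  match s return env C (home_ctx s) -> Ceq s with
  | inl s => fun x => x.1
  | inr E => fun x => eq_proj x
  end.

Fixpoint of_reps G : env C (flat_ctx G) -> env Ceq G :=
  match G return env C (flat_ctx G) -> env Ceq G with
  | [::] => fun _ => tt
  | s :: G' => fun x => (of_rep (env_take x), of_reps (env_drop x))
  end.

Lemma eq_projP (E : def_equiv C) (x y : env C (eq_ctx E)) :
  eq_proj x = eq_proj y <-> eq_holds x y.
Proof.
split=> [xy|xy].
  have : eq_class x y by rewrite [eq_class x](congr1 sval xy); exact: Defs.eq_refl.
  by [].
apply: eq_exist; apply/seteqP; split=> z /= h.
  exact: Defs.eq_trans (Defs.eq_sym xy) h.
exact: Defs.eq_trans xy h.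
Qed.

Lemma of_rep_surj (s : sorts Q) (y : Ceq s) : exists x, of_rep x = y.
Proof.
case: s y => [s y|E [X [x XE]]]; first by exists (y, tt).
by exists x; exact: eq_exist.
Qed.

Definition rep (s : sorts Q) (y : Ceq s) : env C (home_ctx s) :=
  projT1 (cid (of_rep_surj y)).

Lemma of_repK (s : sorts Q) (y : Ceq s) : of_rep (rep y) = y.
Proof. by rewrite /rep; case: cid. Qed.

Fixpoint reps G : env Ceq G -> env C (flat_ctx G) :=
  match G return env Ceq G -> env C (flat_ctx G) with
  | [::] => fun _ => tt
  | s :: G' => fun x => env_cat (rep x.1) (reps x.2)
  end.

Lemma of_repsK G (y : env Ceq G) : of_reps (reps y) = y.
Proof.
elim: G y => [[]|s G IH [u y]] //=.
by rewrite env_take_cat env_drop_cat of_repK IH.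
Qed.

Definition rep_elts (B : set (elt Ceq)) : set (elt C) :=
  \bigcup_(e in B) env_elts (rep (projT2 e)).

Lemma env_in_reps (B : set (elt Ceq)) G (y : env Ceq G) :
  env_in B y -> env_in (rep_elts B) (reps y).
Proof.
elim: G y => [|s G IH] //= [u y] /= [Bu /IH By]; apply: env_in_cat => //.
by apply/env_in_eltsP => e ue; exists (existT _ s u).
Qed.

(** A home element represents itself, so only the finitely many elements of [F] can contribute new
    parameters and smallness is kept. *)
Lemma rep_elts_home (A : set (elt C)) (F : set (elt Ceq)) :
  finite_set F ->
  exists2 F', finite_set F' & rep_elts (@home L C @` A `|` F) `<=` A `|` F'.
Proof.
move=> Ffin; exists (rep_elts F).
  by apply: bigcup_finite => // e _; exact: finite_env_elts.
move=> e [f [[a Aa <-]|Ff] fe]; last by right; exists f.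
left; case: a Aa fe => s a Aa /=.
have := of_repK (s := inl s : sorts Q) a; case: (rep _) => r [] /= ->.
by case=> [->|[]].
Qed.

Lemma of_rep_lookup G s (v : var G s) :
  exists F : env C (flat_ctx G) -> env C (home_ctx s),
    term_map F /\ forall x, of_rep (F x) = lookup v (of_reps x).
Proof.
elim: v => {G s} [G s|G s t v [F [tF FE]]].
  by exists (fun x => env_take x); split=> //; exact: term_map_take.
have tdrop := @term_map_drop L C (home_ctx t) (flat_ctx G).
exists (fun x => F (env_drop x)); split=> [|x] /=; last by rewrite FE.
exact: (term_map_comp tF tdrop).
Qed.

Lemma term_map_home_of_reps (D : seq (sorts L)) :
  term_map (fun x : env C (flat_ctx (map inl D)) =>
              home_env (of_reps x) : env C D).
Proof.
elim: D => [|s D IH] //; split.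
  exact: (@term_fun_lookup L C (s :: flat_ctx (map inl D)) s (VZ _ _)).
exact: (term_map_comp IH (@term_map_snd L C (flat_ctx (map inl D)) s)).
Qed.

Lemma of_reps_eval G :
  (forall s (t : term G s), exists F : env C (flat_ctx G) -> env C (home_ctx s),
     term_map F /\ forall x, of_rep (F x) = eval t (of_reps x)) /\
  (forall D (ts : terms G D),
     exists F : env C (flat_ctx G) -> env C (flat_ctx D),
     term_map F /\ forall x, of_reps (F x) = evals ts (of_reps x)).
Proof.
apply: term_mutind => [s v|f ts|  |s D t [F [tF FE]] ts [F' [tF' FE']]].
- exact: of_rep_lookup.
- case: f ts => [f|E] ts [F [tF FE]].
    have := term_map_comp (term_map_home_of_reps _) tF.
    move=> /term_map_terms[us usE].
    exists (fun x => (fint (home_env (of_reps (F x))), tt)); split.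
      by split=> //; exists (App us) => x /=; rewrite usE.
    by move=> x /=; rewrite FE.
  exists (fun x => home_env (of_reps (F x))); split.
    exact: (term_map_comp (term_map_home_of_reps _) tF).
  by move=> x /=; rewrite FE.
- by exists (fun _ => tt).
- exists (fun x => env_cat (F x) (F' x)); split; first exact: term_map_cat.
  by move=> x /=; rewrite env_take_cat env_drop_cat FE FE'.
Qed.

(** Imaginary sorts are eliminated from formulas: an equation between [E]-classes turns into
    [eq_formula E], and a quantifier over [E]-classes into one over tuples. *)
Lemma definable0_of_reps G (phi : formula G) :
  definable0 (fun x : env C (flat_ctx G) => sat phi (of_reps x : env Ceq G)).
Proof.
elim: phi => {G} [G s t u|G r ts|G|G p IHp q IHq|G s p IH] /=.
- have [F [tF FE]] := (of_reps_eval _).1 _ t.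
  have [F' [tF' FE']] := (of_reps_eval _).1 _ u.
  apply: (@definable0_ext _ _ _ (fun x => of_rep (F x) = of_rep (F' x))).
    by move=> x; rewrite FE FE'.
  move: F F' tF tF' {FE FE'}; clear t u; case: s => [s|E] F F' tF tF' /=.
    exact: (definable0_eq tF.1 tF'.1).
  apply: (@definable0_ext _ _ _
      (fun x => sat (eq_formula E) (env_cat (F x) (F' x)))).
    by move=> x; rewrite eq_projP.
  apply: (definable0_comp (F := fun x => env_cat (F x) (F' x))).
    exact: term_map_cat.
  exact: definable0_sat.
- have [F [tF FE]] := (of_reps_eval _).2 _ ts.
  have := term_map_comp (term_map_home_of_reps _) tF.
  move=> /term_map_terms[us usE]; exists (FRel us) => x /=.
  by rewrite usE FE.
- exact: definable0_False.
- exact: definable0_imp.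
- apply: definable0_ext (definable0_all_env IH) => x /=.
  split=> [H a|H z]; last by rewrite /= env_take_cat env_drop_cat; exact: H.
  have := H (rep a); by rewrite /= env_take_cat env_drop_cat of_repK.
Qed.

Lemma flat_ctx_cat G D :
  exists F : env C (flat_ctx G ++ flat_ctx D) -> env C (flat_ctx (G ++ D)),
    term_map F /\
    forall x y, of_reps (F (env_cat x y)) = env_cat (of_reps x) (of_reps y).
Proof.
elim: G => [|s G [F [tF FE]]] /=.
  by exists id; split; first exact: term_map_id.
pose hd (y : env C ((home_ctx s ++ flat_ctx G) ++ flat_ctx D)) := env_take y.
exists (fun y => env_cat (env_take (hd y))
                         (F (env_cat (env_drop (hd y)) (env_drop y)))); split.
  have thd : term_map hd by exact: term_map_take.
  apply: term_map_cat; first exact: (term_map_comp (term_map_take _ _) thd).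
  apply: (term_map_comp tF); apply: term_map_cat; last exact: term_map_drop.
  exact: (term_map_comp (term_map_drop _ _) thd).
by move=> x y; rewrite /hd !env_take_cat !env_drop_cat FE.
Qed.

Lemma definable_of_reps (B : set (elt Ceq)) G (P : env Ceq G -> Prop) :
  definable B P ->
  definable (rep_elts B) (fun x : env C (flat_ctx G) => P (of_reps x)).
Proof.
move=> [D [phi [v [Bv vE]]]]; have [F [tF FE]] := flat_ctx_cat G D.
have dphi := definable0_comp tF (definable0_of_reps phi).
apply: definable_ext (definable_mk (env_in_reps Bv) dphi) => x.
by rewrite FE of_repsK vE.
Qed.

Fixpoint to_home (D : seq (sorts L)) : env C D -> env Ceq (map inl D) :=
  match D return env C D -> env Ceq (map inl D) with
  | [::] => fun _ => tt
  | s :: D' => fun x => (x.1, to_home x.2)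
  end.

Lemma to_homeK (D : seq (sorts L)) (x : env C D) : home_env (to_home x) = x.
Proof. by elim: D x => [[]|s D IH [u x]] //=; rewrite IH. Qed.

Lemma env_in_home (A : set (elt C)) (D : seq (sorts L)) (x : env C D) :
  env_in A x -> env_in (@home L C @` A) (to_home x).
Proof.
elim: D x => [|s D IH] //= [u x] [/= Au /IH]; split=> //.
by exists (existT _ s u).
Qed.

Lemma term_fun_home (D : seq (sorts L)) s (v : var D s) :
  term_fun (s := inl s : sorts Q)
    (fun y : env Ceq (map inl D) => lookup v (home_env y)).
Proof.
elim: v => {D s} [D s|D s t v IH].
  exact: (@term_fun_lookup Q Ceq _ _ (VZ (map inl D) (inl s : sorts Q))).
have [u uE] := IH.
have [w wE] := (term_subst (term_map_snd (M := Ceq) (map inl D) (inl t))).1 _ u.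
by exists w => y; rewrite wE uE.
Qed.

Lemma home_eval (D : seq (sorts L)) :
  (forall s (t : term D s), term_fun (s := inl s : sorts Q)
     (fun y : env Ceq (map inl D) => eval t (home_env y))) /\
  (forall (D' : seq (sorts L)) (ts : terms D D'),
     exists us : terms (L := Q) (map inl D) (map inl D'),
       forall y : env Ceq (map inl D),
         home_env (evals us y) = evals ts (home_env y)).
Proof.
apply: term_mutind => [s v|f ts [us usE]|  |s D' t [u uE] ts [us usE]].
- exact: term_fun_home.
- by exists (App (f := inl f : func Q) us) => y /=; rewrite usE.
- by exists (TNil _).
- by exists (TCons u us) => y /=; rewrite uE usE.
Qed.

Lemma definable0_home (D : seq (sorts L)) (phi : formula D) :
  definable0 (fun y : env Ceq (map inl D) => sat phi (home_env y)).
Proof.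
elim: phi => {D} [D s t u|D r ts|D|D p IHp q IHq|D s p IH] /=.
- have tt := (home_eval _).1 _ t; have tu := (home_eval _).1 _ u.
  exact: (definable0_eq tt tu).
- have [us usE] := (home_eval _).2 _ ts.
  by exists (FRel (r := r : Defs.rel Q) us) => y /=; rewrite /eq_rint usE.
- exact: definable0_False.
- exact: definable0_imp.
- exact: (definable0_all (s := inl s : sorts Q) IH).
Qed.

Lemma home_env_take (D D' : seq (sorts L)) :
  exists F : env Ceq (map inl (D ++ D')) -> env Ceq (map inl D),
    term_map F /\ forall y, home_env (F y) = env_take (home_env y).
Proof.
elim: D => [|s D [F [tF FE]]] /=; first by exists (fun _ => tt).
exists (fun y => (y.1, F y.2)); split; last by move=> y /=; rewrite FE.
split; first exact: (@term_fun_lookup Q Ceq _ _ (VZ (map inl (D ++ D')) (inl s : sorts Q))).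
exact: (term_map_comp tF (term_map_snd _ _)).
Qed.

Lemma home_env_drop (D D' : seq (sorts L)) :
  exists F : env Ceq (map inl (D ++ D')) -> env Ceq (map inl D'),
    term_map F /\ forall y, home_env (F y) = env_drop (home_env y).
Proof.
elim: D => [|s D [F [tF FE]]] /=.
  by exists id; split; first exact: term_map_id.
exists (fun y => F y.2); split; last by move=> y /=; rewrite FE.
exact: (term_map_comp tF (term_map_snd _ _)).
Qed.

Lemma home_env_cat (D D' : seq (sorts L)) :
  exists F : env Ceq (map inl D ++ map inl D') -> env Ceq (map inl (D ++ D')),
    term_map F /\
    forall x y, home_env (F (env_cat x y)) = env_cat (home_env x) (home_env y).
Proof.
elim: D => [|s D [F [tF FE]]] /=.
  by exists id; split; first exact: term_map_id.
exists (fun y => (y.1, F y.2)); split; last by move=> x y /=; rewrite FE.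
split; last exact: (term_map_comp tF (term_map_snd _ _)).
exact: (@term_fun_lookup Q Ceq _ _ (VZ (map inl D ++ map inl D') (inl s : sorts Q))).
Qed.

Lemma definable_home (A : set (elt C)) (D : seq (sorts L)) (P : env C D -> Prop) :
  definable A P ->
  definable (@home L C @` A) (fun y : env Ceq (map inl D) => P (home_env y)).
Proof.
move=> [D' [phi [v [Av vE]]]]; have [F [tF FE]] := home_env_cat D D'.
have dphi := definable0_comp tF (definable0_home phi).
apply: definable_ext (definable_mk (env_in_home Av) dphi) => x.
by rewrite FE to_homeK vE.
Qed.

(** The projections are function symbols of [Q]. Hence the existence of a representative with a
    definable property is itself definable in [Ceq]. *)
Lemma term_map_of_reps G :
  term_map (fun y : env Ceq (map inl (flat_ctx G)) =>
              of_reps (home_env y) : env Ceq G).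
Proof.
elim: G => //= s G IH; split.
  have [F [/term_map_terms[ts tsE] FE]] := home_env_take (home_ctx s) (flat_ctx G).
  case: s F ts tsE FE => [s|E] F ts tsE FE /=.
    exact: (@term_fun_lookup Q Ceq _ _ (VZ (map inl (flat_ctx G)) (inl s : sorts Q))).
  by exists (App (f := inr E : func Q) ts) => y /=; rewrite tsE FE.
have [F [tF FE]] := home_env_drop (home_ctx s) (flat_ctx G).
have := term_map_comp IH tF.
apply: term_map_ext => y; by rewrite FE.
Qed.

End Representatives.

(** * Automorphisms of the imaginary expansion and their restriction to home sorts *)

Section ImaginaryAutomorphisms.
Variables (L : signature) (C : structure L).
Let Q := eq_signature C.
Let Ceq : structure Q := eq_structure C.
Implicit Types G D : seq (sorts Q).

Lemma env_map_surj (S : Type) (F : S -> Type) (f : forall s, F s -> F s)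
    (G : seq S) (y : env F G) :
  (forall s (u : F s), exists x, f s x = u) -> exists x, env_map f x = y.
Proof.
move=> f_surj; elim: G y => [|s G IH] /=; first by case; exists tt.
by move=> [u y]; have [x <-] := f_surj _ u; have [z <-] := IH y; exists (x, z).
Qed.

Lemma home_env_map (g : forall s, Ceq s -> Ceq s) (D : seq (sorts L))
    (x : env Ceq (map inl D)) :
  home_env (env_map g x) = env_map (fun s => g (inl s)) (home_env x) :> env C D.
Proof. by elim: D x => //= s D IH [u x] /=; rewrite IH. Qed.

(** The projection is a function symbol, so an automorphism acts on a class through any of its
    representatives. *)
Lemma automorphism_of_rep (g : forall s, Ceq s -> Ceq s) s
    (x : env C (home_ctx s)) :
  automorphism g -> g s (of_rep x) = of_rep (env_map (fun s => g (inl s)) x).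
Proof.
case: s x => [s [u []] //|E x] [_ gf _] /=.
have := gf (inr E : func Q) (to_home x).
by rewrite /= home_env_map !to_homeK.
Qed.

Lemma automorphism_of_reps (g : forall s, Ceq s -> Ceq s) G
    (x : env C (flat_ctx G)) :
  automorphism g ->
  env_map g (of_reps x) = of_reps (env_map (fun s => g (inl s)) x).
Proof.
move=> ag; elim: G x => // s G IH x.
rewrite -(env_cat_take_drop (x : env C (home_ctx s ++ flat_ctx G))).
set u := env_take x; set w := env_drop x; rewrite env_map_cat /=.
by rewrite !env_take_cat !env_drop_cat automorphism_of_rep // IH.
Qed.

Variable h : forall s, C s -> C s.
Hypothesis ah : automorphism h.

Definition eq_ext (s : sorts Q) : Ceq s -> Ceq s :=
  match s return Ceq s -> Ceq s with
  | inl s => @h s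
  | inr E => fun X => eq_proj (env_map h (rep X))
  end.

Lemma automorphism_eq_holds (E : def_equiv C) (x y : env C (eq_ctx E)) :
  eq_holds x y <-> eq_holds (env_map h x) (env_map h y).
Proof. by rewrite /eq_holds -env_map_cat; exact: automorphism_sat. Qed.

(** The extension does not depend on the representative chosen by [rep], because [h] preserves the
    formula defining [E]. *)
Lemma eq_ext_proj (E : def_equiv C) (x : env C (eq_ctx E)) :
  eq_ext (eq_proj x : Ceq (inr E)) = eq_proj (env_map h x).
Proof.
apply/eq_projP; rewrite -automorphism_eq_holds -eq_projP.
exact: (of_repK (s := inr E : sorts Q) (eq_proj x)).
Qed.

Lemma home_eq_ext (D : seq (sorts L)) (x : env Ceq (map inl D)) :
  home_env (env_map eq_ext x) = env_map h (home_env x) :> env C D.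
Proof. exact: home_env_map. Qed.

Lemma bij_of_inj_surj (T : Type) (f : T -> T) :
  injective f -> (forall y, exists x, f x = y) -> bijective f.
Proof.
move=> fi fs; exists (fun y => projT1 (cid (fs y))) => x; last by case: cid.
by apply: fi; case: cid.
Qed.

Lemma automorphism_eq_ext : automorphism eq_ext.
Proof.
split=> [[s|E]|[f|E] x|r x].
- by case: ah => /(_ s).
- apply: bij_of_inj_surj => [X Y|Y].
    have [x <-] := of_rep_surj X; have [y <-] := of_rep_surj Y.
    rewrite [of_rep x]/= [of_rep y]/= !eq_ext_proj.
    by move=> /eq_projP hxy; apply/eq_projP; rewrite automorphism_eq_holds.
  have [y <-] := of_rep_surj Y.
  have [x <-] := env_map_surj y (automorphism_surj ah).
  by exists (eq_proj x); rewrite eq_ext_proj.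
- by have [_ hf _] := ah; rewrite /= hf -home_eq_ext.
- by rewrite [LHS]eq_ext_proj -home_eq_ext.
- by have [_ _ hr] := ah; rewrite /= /eq_rint hr -home_eq_ext.
Qed.

End ImaginaryAutomorphisms.

Section CanonicalParameters.
Variables (L : signature) (C : structure L).
Let Q := eq_signature C.
Let Ceq : structure Q := eq_structure C.

(* For [Y] defined by [phi(z, v)], [e] is the class of [v] modulo the relation
   [forall z, phi(z, v) <-> phi(z, v')]. *)
Lemma canonical_parameter (B : set (elt Ceq)) (G : seq (sorts Q))
    (Y : env Ceq G -> Prop) :
  definable B Y ->
  exists e : elt Ceq, forall g : forall s, Ceq s -> Ceq s, automorphism g ->
    g _ (projT2 e) = projT2 e <-> forall z, Y z <-> Y (env_map g z).
Proof.
move=> [D [phi [v [_ vY]]]]; have [F [tF FE]] := flat_ctx_cat G D.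
(* Imaginary sorts exist only for equivalence relations between tuples of home sorts; the arguments
   and parameters of [phi] are therefore replaced by representatives. *)
pose psi y := sat phi (of_reps (F y) : env Ceq (G ++ D)).
have dpsi : definable0 psi by exact: (definable0_comp tF (definable0_of_reps phi)).
pose R (u u' : env C (flat_ctx D)) := forall x : env C (flat_ctx G),
  psi (env_cat x u) <-> psi (env_cat x u').
have [chi chiE] : definable0 (fun w : env C (flat_ctx D ++ flat_ctx D) =>
    R (env_take w) (env_drop w)).
  pose P1 (w : env C (flat_ctx G ++ (flat_ctx D ++ flat_ctx D))) :=
    psi (env_cat (env_take w) (env_take (env_drop w))).
  pose P2 (w : env C (flat_ctx G ++ (flat_ctx D ++ flat_ctx D))) :=
    psi (env_cat (env_take w) (env_drop (env_drop w))).
  have d1 : definable0 P1.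
    apply: (definable0_comp _ dpsi); apply: term_map_cat; first exact: term_map_take.
    exact: (term_map_comp (term_map_take _ _) (term_map_drop _ _)).
  have d2 : definable0 P2.
    apply: (definable0_comp _ dpsi); apply: term_map_cat; first exact: term_map_take.
    exact: (term_map_comp (term_map_drop _ _) (term_map_drop _ _)).
  have := definable0_and (definable0_imp d1 d2) (definable0_imp d2 d1).
  move=> /definable0_all_env; apply: definable0_ext => w.
  by split=> H x; have := H x; rewrite /P1 /P2 env_take_cat env_drop_cat.
have RE u u' : sat chi (env_cat u u') <-> R u u'.
  by rewrite chiE env_take_cat env_drop_cat.
have r (u : env C (flat_ctx D)) : sat chi (env_cat u u) by rewrite RE.
have s (u u' : env C (flat_ctx D)) : sat chi (env_cat u u') -> sat chi (env_cat u' u).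
  by rewrite !RE => H x; rewrite H.
have t (u u' u'' : env C (flat_ctx D)) : sat chi (env_cat u u') -> sat chi (env_cat u' u'') ->
    sat chi (env_cat u u'').
  by rewrite !RE => H H' x; rewrite H H'.
pose E := @DefEquiv L C (flat_ctx D) chi r s t.
exists (@mk_elt Q Ceq (inr E) (eq_proj (reps v : env C (eq_ctx E)))) => g ag.
have gv := automorphism_of_reps (reps v) ag; rewrite of_repsK in gv.
have psiE x w : psi (env_cat x w) <-> sat phi (env_cat (of_reps x) (of_reps w)).
  by rewrite /psi FE.
have phig z : sat phi (env_cat (env_map g z) (env_map g v)) <-> Y z.
  by rewrite -env_map_cat -automorphism_sat.
have -> : (g _ (projT2 (@mk_elt Q Ceq (inr E) (eq_proj (reps v : env C (eq_ctx E))))) =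
    projT2 (@mk_elt Q Ceq (inr E) (eq_proj (reps v : env C (eq_ctx E))))) <->
    forall z, sat phi (env_cat z (env_map g v)) <-> Y z.
  have /= -> := @automorphism_of_rep _ _ g (inr E) (reps v) ag.
  apply: (iff_trans (@eq_projP _ _ E _ _)); apply: (iff_trans (RE _ _)).
  split=> H z.
    by have := H (reps z); rewrite !psiE -gv !of_repsK vY.
  by rewrite !psiE -gv of_repsK vY; exact: H.
split=> H z; first by rewrite -(H (env_map g z)) phig.
have [z' <-] := env_map_surj z (automorphism_surj ag).
by rewrite phig; exact: H.
Qed.

End CanonicalParameters.

(** * Compactness and homogeneity for imaginaries *)

Section ImaginaryMonster.
Variables (L : signature) (C : structure L) (K : Type).
Hypotheses (Kinf : infinite_set [set: K]) (Csat : saturated C K).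
Hypothesis (Chom : strongly_homogeneous C K).
Let Q := eq_signature C.
Let Ceq : structure Q := eq_structure C.
Variables (A : set (elt C)) (sA : small K A).

Lemma eq_compact G (F : set (elt Ceq)) I (X : I -> env Ceq G -> Prop) :
  finite_set F -> inhabited I ->
  (forall i, definable (@home L C @` A `|` F) (X i)) ->
  directed_family X -> (forall i, exists x, X i x) ->
  exists x, forall i, X i x.
Proof.
move=> /(rep_elts_home A)[F' F'fin sF'] I0 dX dirX X0.
have sAF : small K (A `|` F') by exact: small_setU_finite.
have [|||x Xx] := saturated_compact Kinf Csat
  (X := fun i (x : env C (flat_ctx G)) => X i (of_reps x)) sAF I0.
- by move=> i; apply: definable_sub sF' (definable_of_reps (dX i)).
- by move=> i j; have [k kij] := dirX i j; exists k => x /kij.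
- by move=> i; have [y Xy] := X0 i; exists (reps y); rewrite of_repsK.
- by exists (of_reps x).
Qed.

(** The chosen representatives of [c] and [d] need not have the same type over [A]. Compactness
    provides other representatives of [d] that have the type of [reps c]; homogeneity of [C] then
    gives an automorphism of the home sorts, which extends. *)
Lemma eq_homogeneous G (c d : env Ceq G) :
  (forall P : env Ceq G -> Prop, definable (@home L C @` A) P -> P c -> P d) ->
  exists g : forall s, Ceq s -> Ceq s,
    [/\ automorphism g,
        forall e, (@home L C @` A) e -> g _ (projT2 e) = projT2 e &
        env_map g c = d].
Proof.
move=> cd.
pose I := {Z : env C (flat_ctx G) -> Prop | definable A Z /\ Z (reps c)}.
pose mk (Z : env C (flat_ctx G) -> Prop) (dZ : definable A Z)
  (Zc : Z (reps c)) : I := exist _ Z (conj dZ Zc).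
have T : definable A (fun _ : env C (flat_ctx G) => False -> False).
  by apply/definable0W/definable0_imp; exact: definable0_False.
pose X (i : I) (x : env C (flat_ctx G)) := sval i x /\ of_reps x = d.
have d_eq : definable (env_elts d) (fun y : env Ceq G => y = d).
  apply: (@definable_ext _ _ _ _ (fun y => env_take (env_cat y d) = env_drop (env_cat y d))).
    by move=> y; rewrite env_take_cat env_drop_cat.
  apply: (definable_mk (R := fun w => env_take w = env_drop w)).
    exact: env_in_elts.
  by apply: definable0_eq_env; [exact: term_map_take|exact: term_map_drop].
pose B := A `|` rep_elts (env_elts d).
have sB : small K B.
  apply: small_setU_finite => //; apply: bigcup_finite => [|e _];
    exact: finite_env_elts.
have [||||x Xx] := saturated_compact Kinf Csat (X := X) sB.
- exact: (inhabits (mk _ T id)).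
- move=> [Z [dZ Zc]]; apply: definable_and => /=.
    by apply: definable_sub dZ => e; left.
  by apply: definable_sub (definable_of_reps d_eq) => e; right.
- move=> [Z [dZ Zc]] [Z' [dZ' Zc']].
  by exists (mk _ (definable_and dZ dZ') (conj Zc Zc')) => x [/= [? ?] ?].
(* Having a representative in [Z] is definable in [Ceq] over [A] and true of [c], hence true of
   [d]. *)
- move=> [Z [dZ Zc]]; rewrite /X /=.
  apply: (cd (fun y => exists x, Z x /\ of_reps x = y)); last first.
    by exists (reps c); rewrite of_repsK.
  pose P (w : env Ceq (map inl (flat_ctx G) ++ G)) :=
    Z (home_env (env_take w)) /\ of_reps (home_env (env_take w)) = env_drop w.
  have dP : definable (@home L C @` A) P.
    apply: definable_and.
      apply: (definable_comp (P := fun y : env Ceq (map inl (flat_ctx G)) => Z (home_env y))).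
        exact: param_map_take.
      exact: definable_home.
    apply/definable0W/definable0_eq_env; last exact: term_map_drop.
    exact: (term_map_comp (term_map_of_reps G) (term_map_take _ _)).
  apply: definable_ext (definable_ex_env dP) => y; rewrite /P; split.
    by move=> [w]; rewrite env_take_cat env_drop_cat; exists (home_env w).
  by move=> [x ?]; exists (to_home x); rewrite env_take_cat env_drop_cat to_homeK.
have [|h [ah hA hx]] := homogeneous_env Kinf Chom (c := reps c) (d := x) sA.
  by move=> Z dZ Zc; have [] := Xx (mk Z dZ Zc).
exists (eq_ext h); split; first exact: automorphism_eq_ext.
  by move=> _ [e Ae <-]; exact: (hA e Ae).
have [_ <-] := Xx (mk _ T id).
rewrite -hx -(of_repsK c) (automorphism_of_reps (reps c) (automorphism_eq_ext ah)).
by rewrite of_repsK.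
Qed.

End ImaginaryMonster.

(** * Families of convex sets in linear orders *)

Section LinearOrders.
Variables (T : Type).
Implicit Types (X Y : set T) (lt : T -> T -> Prop).

Definition strict_linear X lt : Prop :=
  [/\ forall x, X x -> ~ lt x x,
      forall x y z, X x -> X y -> X z -> lt x y -> lt y z -> lt x z &
      forall x y, X x -> X y -> [\/ lt x y, x = y | lt y x]].

Definition convex X lt Y : Prop :=
  Y `<=` X /\ forall x y z, Y x -> Y y -> X z -> lt x z -> lt z y -> Y z.

Definition convex_union X lt Y : Prop :=
  exists n (Z : 'I_n -> set T), (forall i, convex X lt (Z i)) /\
    Y = \bigcup_i Z i.

Definition flip lt x y := lt y x.

Definition wle lt x y := x = y \/ lt x y.

Lemma strict_linear_flip X lt : strict_linear X lt -> strict_linear X (flip lt).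
Proof.
move=> [irr tr tot]; split=> //; first by move=> x y z *; exact: (tr z y x).
move=> x y Xx Xy; rewrite /flip.
by case: (tot x y Xx Xy); [constructor 3|constructor 2|constructor 1].
Qed.

Lemma convex_flip X lt Y : convex X lt Y -> convex X (flip lt) Y.
Proof.
by move=> [YX cY]; split=> // x y z Yx Yy Xz xz zy; exact: (cY y x z).
Qed.

Lemma convex_union_flip X lt Y : convex_union X lt Y -> convex_union X (flip lt) Y.
Proof.
move=> [n [Z [cZ YE]]]; exists n, Z; split=> // i; exact: convex_flip.
Qed.

Section Order.
Variables (X : set T) (lt : T -> T -> Prop).
Hypothesis ltX : strict_linear X lt.

Lemma strict_linear_sub Y : Y `<=` X -> strict_linear Y lt.
Proof.
case: ltX => irr tr tot YX; split=> [x /YX|x y z /YX ? /YX ? /YX ?|x y /YX ? /YX ?].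
- exact: irr.
- exact: tr.
- exact: tot.
Qed.

Lemma wle_trans x y z : X x -> X y -> X z -> wle lt x y -> wle lt y z -> wle lt x z.
Proof.
case: ltX => _ tr _ Xx Xy Xz [->|xy] // [<-|yz]; right=> //.
exact: (tr x y z).
Qed.

Lemma wle_total x y : X x -> X y -> wle lt x y \/ wle lt y x.
Proof.
case: ltX => _ _ tot Xx Xy; case: (tot x y Xx Xy) => [xy|->|yx].
- by left; right.
- by left; left.
- by right; right.
Qed.

Lemma lt_wle_trans x y z : X x -> X y -> X z -> lt x y -> wle lt y z -> lt x z.
Proof. by case: ltX => _ tr _ Xx Xy Xz xy [<-|yz] //; exact: (tr x y z). Qed.

Lemma wle_lt_trans x y z : X x -> X y -> X z -> wle lt x y -> lt y z -> lt x z.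
Proof. by case: ltX => _ tr _ Xx Xy Xz [->|xy] // yz; exact: (tr x y z). Qed.

Lemma not_lt_wle x y : X x -> X y -> lt x y -> ~ wle lt y x.
Proof.
case: (ltX) => irr _ _ Xx Xy xy yx.
exact: (irr x Xx (lt_wle_trans Xx Xy Xx xy yx)).
Qed.

Lemma not_wle_lt x y : X x -> X y -> ~ wle lt y x -> lt x y.
Proof.
case: ltX => _ _ tot Xx Xy; case: (tot x y Xx Xy) => [//|->|yx] [].
  by left.
by right.
Qed.

Lemma finite_upper_bound n (f : 'I_n -> T) :
  (exists x, X x) -> (forall i, X (f i)) ->
  exists2 m, X m & forall i, wle lt (f i) m.
Proof.
move=> [x0 Xx0]; elim: n f => [|n IH] f Xf; first by exists x0 => // -[].
have [m Xm fm] := IH (fun i => f (lift ord0 i)) (fun i => Xf _).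
have [m0|m0] := wle_total Xm (Xf ord0).
  exists (f ord0) => // i; case: (unliftP ord0 i) => [j ->|->]; last by left.
  exact: wle_trans (fm j) m0.
by exists m => // i; case: (unliftP ord0 i) => [j ->|->].
Qed.

(** If each [Z i] stopped somewhere, the largest of these finitely many stopping points would have
    no element of any [Z i] above it. *)
Lemma cofinal_member n (Z : 'I_n -> set T) :
  (exists x, X x) ->
  (forall x, X x -> exists i y, [/\ X y, wle lt x y & Z i y]) ->
  exists i, forall x, X x -> exists y, [/\ X y, wle lt x y & Z i y].
Proof.
move=> X0 ZX; apply: contrapT => H.
have /choice[f fP] : forall i, exists x, X x /\
    ~ exists y, [/\ X y, wle lt x y & Z i y].
  move=> i; apply: contrapT => Hi; apply: H; exists i => x Xx.
  by apply: contrapT => Hx; apply: Hi; exists x.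
have [m Xm fm] := finite_upper_bound X0 (fun i => (fP i).1).
have [i [y [Xy my Zy]]] := ZX m Xm.
apply: (fP i).2; exists y; split=> //.
exact: (wle_trans (fP i).1 Xm Xy).
Qed.

End Order.

(** One of the convex pieces of [N] is cofinal in [Y], and a convex set cofinal in [Y] contains a
    final segment of it. Weak o-minimality is mostly used in this form. *)
Lemma cofinal_tail X lt Y N :
  strict_linear X lt -> Y `<=` X -> (exists y, Y y) -> convex_union X lt N ->
  (forall x, Y x -> exists y, [/\ Y y, wle lt x y & N y]) ->
  exists2 t, Y t & forall z, Y z -> wle lt t z -> N z.
Proof.
move=> ltX YX Y0 [n [Z [cZ NE]]] cof.
have ltY := strict_linear_sub ltX YX.
have [|i ci] := cofinal_member ltY (Z := Z) Y0.
  move=> x /cof[y [Yy xy]]; rewrite NE => -[i _ Zy].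
  by exists i, y.
have [y Yy] := Y0; have [t [Yt _ Zt]] := ci y Yy.
exists t => // z Yz tz; rewrite NE; exists i => //.
have [u [Yu zu Zu]] := ci z Yz.
case: tz => [<-//|tz]; case: zu => [->//|zu].
have [_] := cZ i; apply; [exact: Zt|exact: Zu|exact: YX|exact: tz|exact: zu].
Qed.

End LinearOrders.

(** * Homogeneous families of convex sets bounded inside their class *)

Section BoundedFamily.
Variables (T U : Type) (P : set T) (Q : set U) (lt : T -> T -> Prop).
Variables (D : T -> U -> Prop).

Definition order_symmetry (V : Type) (X : set V) (ltX : V -> V -> Prop)
    (g : V -> V) : Prop :=
  [/\ forall x, X x <-> X (g x), forall y, exists x, g x = y &
      forall x y, X x -> X y -> ltX x y <-> ltX (g x) (g y)].

(** This is what an automorphism fixing the parameters induces on the realizations of p and q, with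
    [D] standing for the sets [D_z] of the overview. *)
Definition family_symmetry ltQ g h : Prop :=
  [/\ order_symmetry P lt g, order_symmetry Q ltQ h &
      forall x z, D x z <-> D (g x) (h z)].

(** The fiber over [z] consists of all [x] with [D x z]. When [Q] is the set of realizations of q,
    this is the relation ~ of the overview. *)
Definition same_fiber x y := exists z, [/\ Q z, D x z & D y z].

Lemma wle_symmetry (V : Type) (X : set V) ltX g x y : strict_linear X ltX ->
  order_symmetry X ltX g -> X x -> X y -> wle ltX x y <-> wle ltX (g x) (g y).
Proof.
move=> lX [gX _ g_lt] Xx Xy; split=> [[->|xy]|gxy]; first by left.
  by right; exact: (g_lt _ _ Xx Xy).1.
have [gXx gXy] := ((gX x).1 Xx, (gX y).1 Xy).
apply: contrapT => nxy; have yx := not_wle_lt lX Xy Xx nxy.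
exact: (not_lt_wle lX gXy gXx ((g_lt _ _ Xy Xx).1 yx) gxy).
Qed.

Hypothesis ltP : strict_linear P lt.
Hypothesis D_convex : forall x y w z, P x -> P y -> P w -> Q z ->
  lt x w -> lt w y -> D x z -> D y z -> D w z.
Hypothesis sameT : forall x y w, P x -> P y -> P w ->
  same_fiber x y -> same_fiber y w -> same_fiber x w.
Hypothesis D_bounded : forall x z, P x -> Q z -> D x z -> exists c d,
  [/\ P c, P d, same_fiber x c, same_fiber x d &
      forall y, P y -> D y z -> lt c y /\ lt y d].

Lemma same_fiber_sym x y : same_fiber x y -> same_fiber y x.
Proof. by move=> [z [? ? ?]]; exists z. Qed.

(* [J x] is the final segment of those [t] in [R] from which on every fiber
   contains [x].  Fibers being bounded, [J x] shrinks strictly as [x] moves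
   far enough in either direction, and a symmetry carrying a far point on the
   right to one on the left contradicts the convexity of the fibers. *)
Lemma no_bounded_family ltQ (a : T) (R : set U) :
  strict_linear Q ltQ -> P a -> R `<=` Q ->
  (forall x, P x -> same_fiber a x ->
     exists2 t, R t & forall z, R z -> wle ltQ t z -> D x z) ->
  (forall x y, P x -> P y -> same_fiber a x -> same_fiber a y ->
     exists g h, [/\ family_symmetry ltQ g h, g x = y &
       forall t, Q t -> R t <-> R (h t)]) ->
  same_fiber a a -> False.
Proof.
move=> ltQQ Pa RQ tailR sym aa.
pose J x t := R t /\ forall z, R z -> wle ltQ t z -> D x z.
have J_final x t t' : J x t -> R t' -> wle ltQ t t' -> J x t'.
  move=> [Rt Jt] Rt' tt'; split=> // z Rz t'z; apply: Jt => //.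
  by apply: (wle_trans ltQQ (y := t')) => //; exact: RQ.
have JD x t : J x t -> D x t by move=> [Rt]; apply=> //; left.
have exJ x : P x -> same_fiber a x -> exists t, J x t.
  by move=> Px /(tailR x Px)[t Rt Jt]; exists t.
have [t0 Jat0] := exJ a Pa aa.
(* The point [d] lies above the whole fiber over [t0], so [t0] belongs to [J a] and not to [J d]. *)
have [c0 [d [_ Pd _ ad bd]]] := D_bounded Pa (RQ _ Jat0.1) (JD _ _ Jat0).
have irr : forall x, P x -> ~ lt x x by case: ltP.
have a_d : lt a d := (bd _ Pa (JD _ _ Jat0)).2.
have NJdt0 : ~ J d t0 by move=> /JD/(bd _ Pd)[_ /(irr _ Pd)].
have [t1 Jdt1] := exJ d Pd ad.
have t01 : wle ltQ t0 t1.
  have [//|t10] := wle_total ltQQ (RQ _ Jat0.1) (RQ _ Jdt1.1).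
  by case: NJdt0; apply: J_final Jdt1 _ t10; exact: Jat0.1.
have Jat1 := J_final _ _ _ Jat0 Jdt1.1 t01.
(* The fiber over [t1] contains both [d] and [a]; the point [c] below it satisfies [lt c a], and
   [t1] is not in [J c]. *)
have [c [d0 [Pc _ dc _ bc]]] := D_bounded Pd (RQ _ Jdt1.1) (JD _ _ Jdt1).
have ac : same_fiber a c := sameT Pa Pd Pc ad dc.
have c_a : lt c a := (bc _ Pa (JD _ _ Jat1)).1.
have NJct1 : ~ J c t1 by move=> /JD/(bc _ Pc)[/(irr _ Pc)].
(* Carrying [d] to [c] puts [g a] below [c]; moreover [h t0] lies in [J (g a)] but not in [J c], the
   image of [J d]. *)
have [g [h [[sg sh gD] gdc hR]]] := sym _ _ Pd Pc ad ac.
have [gP _ g_lt] := sg; have [hQ h_surj _] := sh.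
have Jgh x t : J x t <-> J (g x) (h t).
  split=> -[Rt Jt].
    split=> [|z Rz htz]; first exact: (hR _ (RQ _ Rt)).1.
    have [w wz] := h_surj z; rewrite -{z}wz in Rz htz *.
    have Qw : Q w by apply/hQ; exact: RQ.
    apply: (gD _ _).1; apply: Jt; first exact: (hR _ Qw).2.
    exact: (wle_symmetry ltQQ sh (RQ _ Rt) Qw).2.
  have Qt : Q t by apply/hQ; exact: RQ.
  split=> [|z Rz tz]; first exact: (hR _ Qt).2.
  have Qz := RQ _ Rz; apply: (gD _ _).2; apply: Jt; first exact: (hR _ Qz).1.
  exact: (wle_symmetry ltQQ sh Qt Qz).1.
have Pga : P (g a) := (gP a).1 Pa.
have ga_c : lt (g a) c by rewrite -gdc; exact: (g_lt _ _ Pa Pd).1.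
have Jga : J (g a) (h t0) := (Jgh a t0).1 Jat0.
have NJc : ~ J c (h t0) by rewrite -gdc => /(Jgh d t0).2.
have JJ t : J (g a) t -> J a t -> J c t.
  move=> [Rt Jt] [_ Jt']; split=> // z Rz tz.
  by apply: (D_convex Pga Pa Pc (RQ _ Rz)) => //; [exact: Jt|exact: Jt'].
(* Since [J (g a)] and [J a] are final segments, the larger of [h t0] and [t1] lies in both, hence
   in [J c] because [c] is between [g a] and [a]. But neither point is in [J c]. *)
have [ht|th] := wle_total ltQQ (RQ _ Jga.1) (RQ _ Jat1.1).
  by apply: NJct1; apply: JJ => //; exact: J_final Jga Jat1.1 ht.
by apply: NJc; apply: JJ => //; exact: J_final Jat1 Jga.1 th.
Qed.

Variable ltQ : U -> U -> Prop.
Hypothesis ltQQ : strict_linear Q ltQ.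
Hypothesis fiber_convex_union : forall x, P x ->
  convex_union Q ltQ [set z | Q z /\ D x z].
Hypothesis sameR : forall x, P x -> same_fiber x x.
Hypothesis transP : forall x y, P x -> P y ->
  exists g h, family_symmetry ltQ g h /\ g x = y.

Lemma order_symmetry_flip (V : Type) (X : set V) ltX g :
  order_symmetry X ltX g -> order_symmetry X (flip ltX) g.
Proof. by move=> [gX gs g_lt]; split=> // x y Xx Xy; exact: g_lt. Qed.

Lemma family_symmetry_flip g h :
  family_symmetry ltQ g h -> family_symmetry (flip ltQ) g h.
Proof. by move=> [sg sh gD]; split=> //; exact: order_symmetry_flip. Qed.

Lemma same_fiber_symmetry g h x y : family_symmetry ltQ g h ->
  same_fiber x y <-> same_fiber (g x) (g y).
Proof.
move=> [_ [hQ h_surj _] gD]; split=> -[z [Qz xz yz]].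
  by exists (h z); split; [exact: (hQ z).1|exact: (gD x z).1|exact: (gD y z).1].
have [w wz] := h_surj z; rewrite -{z}wz in Qz xz yz.
by exists w; split; [exact: (hQ w).2|exact: (gD x w).2|exact: (gD y w).2].
Qed.

(* [L] is the lower cut of the filter generated by the sets
   [D x `&` D y] with [x] and [y] in the fiber class of [a]. *)
Lemma no_bounded_transitive_family (a : T) : P a -> False.
Proof.
move=> Pa.
pose X x := P x /\ same_fiber a x.
have Xa : X a by split=> //; exact: sameR.
have Xsame x y : X x -> X y -> same_fiber x y.
  move=> [Px ax] [Py ay]; exact: (sameT Px Pa Py (same_fiber_sym ax) ay).
pose L : set U := fun t => Q t /\ forall x y, X x -> X y ->
  exists z, [/\ Q z, D x z, D y z & ltQ t z].
(* A symmetry that keeps one point of the class inside the class maps the class onto itself, and so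
   preserves the cut computed from it. *)
have Linv g h x : family_symmetry ltQ g h -> X x -> X (g x) ->
    forall t, Q t -> L t <-> L (h t).
  move=> sgh Xx Xgx; have [[gP g_surj _] [hQ h_surj h_lt] gD] := sgh.
  have gX y : X y <-> X (g y).
    split=> -[Py ay].
      have Pgy := (gP y).1 Py; split=> //; apply: (sameT Pa Xgx.1 Pgy Xgx.2).
      exact: (same_fiber_symmetry _ _ sgh).1 (Xsame _ _ Xx (conj Py ay)).
    have Py' := (gP y).2 Py; split=> //; apply: (sameT Pa Xx.1 Py' Xx.2).
    exact: (same_fiber_symmetry _ _ sgh).2 (Xsame _ _ Xgx (conj Py ay)).
  move=> t Qt; split=> -[_ Lt]; split=> [|u v Xu Xv].
  - exact: (hQ t).1.
  - have [u' u'u] := g_surj u; have [v' v'v] := g_surj v.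
    rewrite -{u}u'u -{v}v'v in Xu Xv *.
    have [z [Qz uz vz tz]] := Lt u' v' ((gX _).2 Xu) ((gX _).2 Xv).
    by exists (h z); split; [exact: (hQ z).1|exact: (gD _ z).1|exact: (gD _ z).1|
      exact: (h_lt t z Qt Qz).1].
  - by [].
  - have [z [Qz uz vz tz]] := Lt (g u) (g v) ((gX _).1 Xu) ((gX _).1 Xv).
    have [w wz] := h_surj z; rewrite -{z}wz in Qz uz vz tz.
    have Qw := (hQ w).2 Qz.
    by exists w; split=> //; [exact: (gD _ w).2|exact: (gD _ w).2|
      exact: (h_lt t w Qt Qw).2].
have LQ : L `<=` Q by move=> t [].
(* If every set of [z] with [D x z] recurs cofinally in [L], the cut is approached from below;
   otherwise it is approached from above, through the complement of [L] and the reversed order. *)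
have [[[t0 Lt0] Lcof]|NL] := pselect ((exists t, L t) /\
    forall x, X x -> forall t, L t -> exists z, [/\ L z, wle ltQ t z & D x z]).
  apply: (no_bounded_family ltQQ Pa LQ) (sameR Pa) => [x Px ax|x y Px Py ax ay].
    have [] := cofinal_tail ltQQ LQ (ex_intro _ t0 Lt0) (fiber_convex_union Px).
      move=> t Lt; have [z [Lz tz xz]] := Lcof x (conj Px ax) t Lt.
      by exists z; split=> //; split=> //; exact: LQ.
    by move=> t Lt tail; exists t => // z Lz /(tail _ Lz)[].
  have [g [h [sgh gxy]]] := transP Px Py; exists g, h; split=> //.
  by apply: (Linv g h x sgh); [|rewrite gxy].
pose R : set U := Q `\` L.
have RQ : R `<=` Q by move=> t [].
have XP : X `<=` P by move=> x [].
(* By convexity, a fiber containing the least and the greatest of four points contains all four.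
   Hence the pairwise intersections form a filter base. *)
have directed x1 y1 x2 y2 : X x1 -> X y1 -> X x2 -> X y2 -> exists x y,
    [/\ X x, X y & forall z, Q z -> D x z -> D y z ->
       [/\ D x1 z, D y1 z, D x2 z & D y2 z]].
  move=> X1 Y1 X2 Y2.
  pose f (i : 'I_4) := nth x1 [:: x1; y1; x2; y2] i.
  have Xf i : X (f i) by case: i => -[|[|[|[|]]]].
  have ltX := strict_linear_sub ltP XP.
  have X0 : exists x, X x by exists a.
  have [M XM fM] := finite_upper_bound ltX X0 Xf.
  have [m Xm fm] := finite_upper_bound (strict_linear_flip ltX) X0 Xf.
  exists m, M; split=> // z Qz mz Mz.
  have fz i : D (f i) z.
    case: (fm i) => [->//|mi]; case: (fM i) => [->//|iM].
    exact: (D_convex (XP _ Xm) (XP _ XM) (XP _ (Xf i)) Qz mi iM).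
  split.
  - exact: (fz (@Ordinal 4 0 isT)).
  - exact: (fz (@Ordinal 4 1 isT)).
  - exact: (fz (@Ordinal 4 2 isT)).
  - exact: (fz (@Ordinal 4 3 isT)).
(* If all common points of [D x] and [D y] were in [L], then [L] would be nonempty. For [w] in the
   class and [t] in [L], a point above [t] common to [D x], [D y] and [D w] would lie in [L], which
   is the case already treated. *)
have Rinf x y : X x -> X y -> exists z, [/\ R z, D x z & D y z].
  move=> Xx Xy; apply: contrapT => NR; apply: NL; split.
    have [z [Qz xz yz]] := Xsame x y Xx Xy.
    by exists z; apply: contrapT => NLz; apply: NR; exists z.
  move=> w Xw t Lt; apply: contrapT => Nt; apply: NR.
  have [x' [y' [Xx' Xy' xy']]] := directed x y w w Xx Xy Xw Xw.
  have [z [Qz x'z y'z tz]] := Lt.2 x' y' Xx' Xy'.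
  have [xz yz wz _] := xy' z Qz x'z y'z.
  exists z; split=> //; split=> // Lz.
  by apply: Nt; exists z; split=> //; right.
have [r [Rr _ _]] := Rinf a a Xa Xa.
have ltQ' := strict_linear_flip ltQQ.
apply: (no_bounded_family ltQ' Pa RQ) (sameR Pa) => [x Px ax|x y Px Py ax ay].
  have [] := cofinal_tail ltQ' RQ (ex_intro _ r Rr)
    (convex_union_flip (fiber_convex_union Px)).
    (* As [t] is outside [L], some [D u] and [D v] have no common point above [t]. Intersecting with
       them forces the point supplied by [Rinf] to be at or below [t]. *)
    move=> t [Qt NLt]; have [u [v [Xu Xv Nuv]]] : exists u v, [/\ X u, X v &
        ~ exists z, [/\ Q z, D u z, D v z & ltQ t z]].
      apply: contrapT => H; apply: NLt; split=> // u v Xu Xv.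
      by apply: contrapT => Huv; apply: H; exists u, v.
    have Xx : X x by [].
    have [x' [y' [Xx' Xy' xy']]] := directed x x u v Xx Xx Xu Xv.
    have [z [Rz x'z y'z]] := Rinf x' y' Xx' Xy'.
    have [xz _ uz vz] := xy' z (RQ _ Rz) x'z y'z.
    exists z; split=> //; last by split=> //; exact: RQ.
    have [E|E] := pselect (wle (flip ltQ) t z) => //.
    case: Nuv; exists z; split=> //; first exact: RQ.
    exact: (not_wle_lt ltQ' (RQ _ Rz) Qt E).
  by move=> t Rt tail; exists t => // z Rz /(tail _ Rz)[].
have [g [h [sgh gxy]]] := transP Px Py; exists g, h; split=> //.
  exact: family_symmetry_flip.
move=> t Qt; have LE : L t <-> L (h t) by apply: (Linv g h x sgh); [|rewrite gxy|].
have [_ [hQ _ _] _] := sgh.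
split=> -[_ NLt]; split=> //; first exact: (hQ t).1.
  by move/(LE.2).
by move/(LE.1).
Qed.

End BoundedFamily.

(** * Weakly o-minimal types *)

Lemma param_map_nil (L : signature) (M : structure L) (B : set (elt M)) D
    (F : env M D -> env M [::]) : param_map B F.
Proof. by []. Qed.

Lemma param_map_cons (L : signature) (M : structure L) (B : set (elt M)) D s G
    (F : env M D -> env M (s :: G)) :
  param_fun B (fun x => (F x).1) -> param_map B (fun x => (F x).2) ->
  param_map B F.
Proof. by []. Qed.

Ltac param_fun_auto :=
  first [ left; exists (VZ _ _) => ?; reflexivity
        | left; exists (VS _ (VZ _ _)) => ?; reflexivity
        | left; exists (VS _ (VS _ (VZ _ _))) => ?; reflexivity
        | left; exists (VS _ (VS _ (VS _ (VZ _ _)))) => ?; reflexivity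
        | left; exists (VS _ (VS _ (VS _ (VS _ (VZ _ _))))) => ?; reflexivity
        | right; eexists; split; [|move=> ?; reflexivity]; rewrite /=; tauto ].

Ltac param_auto :=
  repeat (apply: param_map_cons; first by rewrite /=; param_fun_auto);
  exact: param_map_nil.

Section SaturatedHomogeneous.
Variables (L : signature) (M : structure L) (B : set (elt M)).

(** The monster enters only through compactness with finitely many extra parameters, homogeneity
    over [B], and codes of definable sets. The imaginary expansion has all three, with [B] the image
    of the small set [A]. *)
Hypothesis M_compact : forall G (F : set (elt M)) I (X : I -> env M G -> Prop),
  finite_set F -> inhabited I -> (forall i, definable (B `|` F) (X i)) ->
  directed_family X -> (forall i, exists x, X i x) -> exists x, forall i, X i x.

Definition fixes (g : forall s, M s -> M s) : Prop :=
  automorphism g /\ forall e, B e -> g _ (projT2 e) = projT2 e.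

Hypothesis M_homogeneous : forall G (c d : env M G),
  (forall P : env M G -> Prop, definable B P -> P c -> P d) ->
  exists2 g, fixes g & env_map g c = d.

Hypothesis M_canonical : forall B' G (Y : env M G -> Prop), definable B' Y ->
  exists e : elt M, forall g, automorphism g ->
    g _ (projT2 e) = projT2 e <-> forall z, Y z <-> Y (env_map g z).

Lemma fixes_definable g G (P : env M G -> Prop) x :
  fixes g -> definable B P -> P x <-> P (env_map g x).
Proof. by move=> [ag gB] dP; exact: (automorphism_definable ag _ gB dP). Qed.

Lemma definable_True (B' : set (elt M)) G : definable B' (fun _ : env M G => True).
Proof.
have dF := definable_False B' G.
by apply: definable_ext (definable_imp dF dF) => x; split.
Qed.

Lemma definable_subst (B' : set (elt M)) D G (F : env M D -> env M G)
    (P : env M G -> Prop) :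
  definable B P -> B `<=` B' -> param_map B' F -> definable B' (fun x => P (F x)).
Proof. by move=> dP sB pF; apply: (definable_comp pF); exact: definable_sub dP. Qed.

Fixpoint all_hold D G (Z : env M G -> Prop) (l : seq (env M D -> env M G))
    (w : env M D) : Prop :=
  if l is f :: l' then Z (f w) /\ all_hold Z l' w else True.

Fixpoint all_param (B' : set (elt M)) D G (l : seq (env M D -> env M G)) : Prop :=
  if l is f :: l' then param_map B' f /\ all_param B' l' else True.

Lemma all_hold_definable B' D G (Z : env M G -> Prop)
    (l : seq (env M D -> env M G)) :
  definable B' Z -> all_param B' l -> definable B' (all_hold Z l).
Proof.
move=> dZ; elim: l => [|f l IH] /=; first by move=> _; exact: definable_True.
by move=> [pf /IH dl]; apply: definable_and => //; exact: definable_comp dZ.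
Qed.

Lemma all_hold_sub D G (Z Z' : env M G -> Prop) (l : seq (env M D -> env M G)) w :
  (forall x, Z x -> Z' x) -> all_hold Z l w -> all_hold Z' l w.
Proof. by move=> ZZ'; elim: l => //= f l IH [/ZZ' ? /IH]. Qed.

(* The hypothesis on [w] says that each [f w] with [f] in [l1] realizes the type
   of [c1] over [B], and each [f w] with [f] in [l2] that of [c2]. *)
Lemma type_compact D (F : set (elt M)) (Bad : env M D -> Prop)
    G1 (c1 : env M G1) (l1 : seq (env M D -> env M G1))
    G2 (c2 : env M G2) (l2 : seq (env M D -> env M G2)) :
  finite_set F -> definable (B `|` F) Bad ->
  all_param (B `|` F) l1 -> all_param (B `|` F) l2 ->
  (forall w, (forall Z, definable B Z -> Z c1 -> all_hold Z l1 w) ->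
     (forall Z, definable B Z -> Z c2 -> all_hold Z l2 w) -> ~ Bad w) ->
  exists Z1 Z2, [/\ definable B Z1, Z1 c1, definable B Z2, Z2 c2 &
    forall w, all_hold Z1 l1 w -> all_hold Z2 l2 w -> ~ Bad w].
Proof.
move=> Ffin dBad pl1 pl2 NBad; apply: contrapT => H.
pose I := {Z : (env M G1 -> Prop) * (env M G2 -> Prop) |
  [/\ definable B Z.1, Z.1 c1, definable B Z.2 & Z.2 c2]}.
pose mk Z1 Z2 (d1 : definable B Z1) (h1 : Z1 c1) (d2 : definable B Z2)
    (h2 : Z2 c2) : I :=
  exist _ (Z1, Z2) (And4 d1 h1 d2 h2).
pose X (i : I) w := [/\ all_hold (sval i).1 l1 w, all_hold (sval i).2 l2 w & Bad w].
have T1 := definable_True B G1; have T2 := definable_True B G2.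
have sB : B `<=` B `|` F by move=> e; left.
have [||||w Xw] := M_compact (X := X) Ffin.
- exact: (inhabits (mk _ _ T1 Logic.I T2 Logic.I)).
- move=> [[Z1 Z2] [d1 h1 d2 h2]].
  apply: (@definable_ext _ _ _ _ (fun w => all_hold Z1 l1 w /\ (all_hold Z2 l2 w /\ Bad w))).
    by move=> w; split=> [[? []]|[]].
  apply: definable_and; first by apply: all_hold_definable => //; exact: definable_sub d1.
  apply: definable_and => //; apply: all_hold_definable => //; exact: definable_sub d2.
- move=> [[Z1 Z2] [d1 h1 d2 h2]] [[Z1' Z2'] [d1' h1' d2' h2']].
  exists (mk _ _ (definable_and d1 d1') (conj h1 h1') (definable_and d2 d2') (conj h2 h2')).
  move=> w [/= H1 H2 Bw]; split; split=> //=.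
  - by apply: all_hold_sub H1 => ? [].
  - by apply: all_hold_sub H2 => ? [].
  - by apply: all_hold_sub H1 => ? [].
  - by apply: all_hold_sub H2 => ? [].
- move=> [[Z1 Z2] [d1 h1 d2 h2]]; apply: contrapT => Nw; apply: H.
  by exists Z1, Z2; split=> // w w1 w2 Bw; apply: Nw; exists w.
apply: (NBad w); last by case: (Xw (mk _ _ T1 Logic.I T2 Logic.I)).
  by move=> Z dZ Zc; case: (Xw (mk _ _ dZ Zc T2 Logic.I)).
by move=> Z dZ Zc; case: (Xw (mk _ _ T1 Logic.I dZ Zc)).
Qed.

Lemma dcl_fixed e b g : dcl (B `|` [set b]) e -> fixes g ->
  g _ (projT2 b) = projT2 b -> g _ (projT2 e) = projT2 e.
Proof.
move=> [[D phi v] [/= Bv phie phi1]] [ag gB] gb; apply: phi1.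
have gBb c : (B `|` [set b]) c -> g _ (projT2 c) = projT2 c.
  by case=> [/gB|->].
have := (automorphism_psat ag phi v (elt_env e)).1 phie.
by rewrite (env_map_fixed gBb Bv).
Qed.

(** By homogeneity [e] is the only realization of its type over [B] and [b]; by compactness a single
    formula of that type already has [e] as its only solution. *)
Lemma fixed_dcl e b :
  (forall g, fixes g -> g _ (projT2 b) = projT2 b -> g _ (projT2 e) = projT2 e) ->
  dcl (B `|` [set b]) e.
Proof.
case: e b => [se e] [sb b] /= fixed.
have [|||||Z [Z' [dZ Zeb _ _ ZE]]] := type_compact (F := [set mk_elt e; mk_elt b])
  (Bad := fun y : env M [:: se] => y.1 <> e)
  (c1 := (e, (b, tt)) : env M [:: se; sb])
  (l1 := [:: fun y : env M [:: se] => (y.1, (b, tt)) : env M [:: se; sb]])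
  (c2 := tt : env M [::]) (l2 := [::]).
- by rewrite finite_setU; split; exact: finite_set1.
- apply: definable_not; apply: definable_eq; first exact: (param_fun_lookup _ (VZ _ _)).
  by apply: param_fun_const; right; left.
- by split=> //; param_auto.
- by [].
- move=> [y []] H _ /=; apply.
  have [g fg [gey gb]] : exists2 g, fixes g & env_map g ((e, (b, tt)) : env M [:: se; sb]) = (y, (b, tt)).
    by apply: M_homogeneous => P dP Pe; case: (H P dP Pe).
  by rewrite -gey; exact: fixed.
have : definable (B `|` [set mk_elt b]) (fun y : env M [:: se] => Z (y.1, (b, tt))).
  apply: (definable_subst (F := fun y : env M [:: se] => (y.1, (b, tt)) : env M [:: se; sb])) dZ _ _.
    by move=> ? ?; left.
  by param_auto.
move=> /definable_pformula[phi [Bphi phiE]]; exists phi; split=> //.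
  by apply/phiE.
move=> y /phiE /= Zy; apply: contrapT => ne.
exact: (ZE (y, tt)).
Qed.


Section OneType.
Variables (s : sorts L) (a : M s) (lt : M s -> M s -> Prop).
Let p := tp B (env1 a).

Lemma locusP x : locus p x <-> exists2 g, fixes g & g s a = x.
Proof.
split=> [px|[g fg <-] phi [Bphi phia]].
  have [|g fg [gax]] := M_homogeneous (c := env1 a) (d := env1 x); last by exists g.
  move=> P /definable_pformula[phi [Bphi phiE]] /phiE phia.
  by apply/phiE; exact: (px phi (conj Bphi phia)).
have dphi := definable_psat Bphi.
exact: (fixes_definable (env1 a) fg dphi).1 phia.
Qed.

Lemma locus_definable x (P : env M [:: s] -> Prop) :
  locus p x -> definable B P -> P (env1 a) <-> P (env1 x).
Proof. by move=> /locusP[g fg <-] dP; exact: (fixes_definable (env1 a) fg dP). Qed.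

Lemma locus_refl : locus p a.
Proof. by move=> phi []. Qed.

Lemma locus_fixes g x : fixes g -> locus p x <-> locus p (g s x).
Proof.
move=> fg; split=> px phi pphi; have [Bphi _] := pphi;
  have := fixes_definable (env1 x) fg (definable_psat Bphi).
  by move=> <-; exact: px.
by move=> ->; exact: px.
Qed.

Lemma locus_transitive x y : locus p x -> locus p y ->
  exists2 g, fixes g & g s x = y.
Proof.
move=> px py.
have [|g fg [gxy]] := M_homogeneous (c := env1 x) (d := env1 y); last by exists g.
by move=> P dP; rewrite -(locus_definable px dP) -(locus_definable py dP).
Qed.

Lemma rel_definable2P (R : M s -> M s -> Prop) : rel_definable2 p B R ->
  exists2 Z : env M [:: s; s] -> Prop, definable B Z &
    forall x y, R x y <-> [/\ Z (x, (y, tt)), locus p x & locus p y].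
Proof.
move=> [phi [Bphi RE]]; exists (psat phi); first exact: definable_psat.
move=> x y; have := congr1 (fun Y : set (env M [:: s; s]) => Y (x, (y, tt))) RE.
rewrite /= => ->; split=> [[? [? []]]|[]] //.
Qed.

Lemma rel_definable2_fixes (R : M s -> M s -> Prop) g x y :
  rel_definable2 p B R -> fixes g -> R x y <-> R (g s x) (g s y).
Proof.
move=> /rel_definable2P[Z dZ RE] fg; rewrite !RE.
have ZE := fixes_definable ((x, (y, tt)) : env M [:: s; s]) fg dZ.
have [px py] := (locus_fixes x fg, locus_fixes y fg).
split=> -[Zxy ? ?]; split; [exact: ZE.1|exact: px.1|exact: py.1|..].
- exact: ZE.2.
- exact: px.2.
- exact: py.2.
Qed.

Hypothesis lt_wom : wom_pair B p lt.

Lemma wom_linear : strict_linear (locus p) lt.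
Proof. by case: lt_wom. Qed.

Lemma wom_convex_union B' (P : env M [:: s] -> Prop) : definable B' P ->
  convex_union (locus p) lt [set x | P (env1 x) /\ locus p x].
Proof.
move=> /definable_pformula[phi [Bphi phiE]]; have [_ _ _ wom] := lt_wom.
apply: (wom B'); exists phi; split=> //; apply/seteqP; split=> -[x []] /=.
  by move=> [Px px]; split=> //; exact: (phiE _).2.
by move=> [Px [px _]]; split=> //; exact: (phiE _).1.
Qed.

Lemma wom_fixes g x y : fixes g -> lt x y <-> lt (g s x) (g s y).
Proof. by move=> fg; case: lt_wom => _ rlt _ _; exact: (rel_definable2_fixes _ _ rlt fg). Qed.

Lemma fixes_order_symmetry g : fixes g -> order_symmetry (locus p) lt (g s).
Proof.
move=> fg; split=> [x|y|x y _ _]; first exact: locus_fixes.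
  by have [ag _] := fg; exact: automorphism_surj.
exact: wom_fixes.
Qed.

End OneType.


(** * Forking over the common definable closure of two elements *)

Section TwoTypes.
Variables (s t : sorts L) (a : M s) (b : M t).
Let p := tp B (env1 a).
Let q := tp B (env1 b).
Let m := meet_dcl B (mk_elt a) (mk_elt b).

Definition env2 s1 s2 (x : M s1) (y : M s2) : env M [:: s1; s2] := (x, (y, tt)).

(** The realizations of the type of [a] over [B] and [b], presented as an orbit. *)
Definition over_b (x : M s) : Prop :=
  exists g, [/\ fixes g, g t b = b & g s a = x].

Lemma over_bP x : over_b x <->
  forall Z, definable B Z -> Z (env2 a b) -> Z (env2 x b).
Proof.
split=> [[g [fg gb gax]] Z dZ|H].
  by move=> /(fixes_definable _ fg dZ)/=; rewrite gax gb.
have [g fg [gax gb]] := M_homogeneous H.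
by exists g.
Qed.

Lemma over_b_locus x : over_b x -> locus p x.
Proof. by move=> [g [fg _ gax]]; apply/locusP; exists g. Qed.

Lemma over_b_refl : over_b a.
Proof. by apply/over_bP. Qed.

Lemma sub_meet_dcl : B `<=` m.
Proof. by move=> e Be; split; apply: fixed_dcl => g [_ gB] _; exact: gB. Qed.

(** Automorphisms fixing [B] and [b] fix [m] pointwise, since [m] lies in the definable closure of
    [B] and [b]. A cover of the type over [m] and [b] thus covers the whole orbit [over_b]. *)
Lemma over_b_realizes x : over_b x ->
  realizes (tp (m `|` [set mk_elt b]) (env1 a)) (env1 x).
Proof.
move=> [g [fg gb <-]] [D phi v] [/= mv phia].
have gmb e : (m `|` [set mk_elt b]) e -> g _ (projT2 e) = projT2 e.
  by case=> [[_ eb]|->] //; exact: (dcl_fixed eb fg).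
have := (automorphism_psat fg.1 phi v (env1 a)).1 phia.
by rewrite (env_map_fixed gmb mv).
Qed.

(* If [g] fixes [b] and maps [x] to [z], a definable set over [b] separating
   [x] and [z] from a point between them alternates infinitely often along the
   orbit of [g]. *)
Lemma over_b_convex lt x y z : wom_pair B p lt -> over_b x -> over_b z ->
  locus p y -> lt x y -> lt y z -> over_b y.
Proof.
move=> lt_wom bx bz py xy yz; apply: contrapT => Nby.
have [Z [dZ Zab NZyb]] : exists Z, [/\ definable B Z, Z (env2 a b) & ~ Z (env2 y b)].
  apply: contrapT => H; apply: Nby; apply/over_bP => Z dZ Zab.
  by apply: contrapT => NZ; apply: H; exists Z.
have [|g fg [gxz gb]] := M_homogeneous (c := env2 x b) (d := env2 z b).
  move=> Q dQ; move/over_bP: bx => bx; move/over_bP: bz => bz Qx.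
  apply: bz => //; apply: contrapT => NQ.
  exact: (bx _ (definable_not dQ) NQ).
have Zg u : Z (env2 u b) <-> Z (env2 (g s u) b).
  by rewrite (fixes_definable (env2 u b) fg dZ) /= gb.
(* The two orbits interlace as [xs 0 < ys 0 < xs 1 < ys 1 < ...], starting from [x < y < z]; [Z]
   holds along [xs] and fails along [ys]. *)
pose xs k := iter k (g s) x; pose ys k := iter k (g s) y.
have [px pz] := (over_b_locus bx, over_b_locus bz).
have pxs k : locus p (xs k) by elim: k => //= k /(locus_fixes _ _ fg).1.
have pys k : locus p (ys k) by elim: k => //= k /(locus_fixes _ _ fg).1.
have xys k : lt (xs k) (ys k) by elim: k => //= k /(wom_fixes lt_wom _ _ fg).1.
have yxs k : lt (ys k) (xs k.+1).
  by elim: k => [|k /(wom_fixes lt_wom _ _ fg).1] //=; rewrite gxz.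
have ltX := wom_linear lt_wom.
have mono k l : (k < l)%N -> lt (ys k) (xs l).
  elim: l => // l IH; rewrite ltnS leq_eqVlt => /orP[/eqP->|/IH kl] //.
  have [_ tr _] := ltX; apply: (tr _ (xs l)) => //.
  exact: (tr _ (ys l)).
have Zxs k : Z (env2 (xs k) b).
  elim: k => [|k IH]; last exact: (Zg _).1 IH.
  exact: (over_bP x).1 bx _ dZ Zab.
have NZys k : ~ Z (env2 (ys k) b) by elim: k => //= k IH /(Zg _).2.
have dZb : definable (B `|` [set mk_elt b]) (fun u : env M [:: s] => Z (env2 u.1 b)).
  apply: (definable_subst (F := fun u : env M [:: s] => env2 u.1 b) dZ).
    by move=> ? ?; left.
  by rewrite /env2; param_auto.
have [n [Y [cY YE]]] := wom_convex_union lt_wom dZb.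
have /choice[i iP] : forall k : nat, exists i, Y i (xs k).
  move=> k; have : (\bigcup_i Y i) (xs k) by rewrite -YE; split; [exact: Zxs|].
  by move=> [i _ ?]; exists i.
(* These are one point more than there are convex pieces, so two of the [xs] share a piece, and that
   piece contains a point of [ys] between them. *)
pose f (k : 'I_n.+1) := i k.
have /injectivePn[k [l kl fkl]] : ~~ injectiveb f.
  apply/negP => /injectiveP/leq_card; by rewrite !card_ord ltnn.
wlog lekl : k l kl fkl / (k < l)%N.
  move=> H; move: (kl); rewrite -val_eqE neq_ltn => /orP[|lk]; first exact: H.
  by apply: (H l k) => //; rewrite eq_sym.
have : (\bigcup_i Y i) (ys k).
  exists (f k) => //; have [_ cYk] := cY (f k).
  apply: (cYk _ _ _ (iP k) _ (pys k) (xys k) (mono _ _ lekl)).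
  by rewrite fkl; exact: iP.
by rewrite -YE => -[/NZys].
Qed.

(* The class of [a] modulo [V] has a canonical parameter [e] in [m], so the
   conjugates of [phi] over [m] all contain a final segment of that class. *)
Lemma final_segment_not_divides (phi : pformula M [:: s])
    (V : env M [:: s; s] -> Prop) (lt : M s -> M s -> Prop) (x0 : M s) :
  definable B V ->
  (forall x y z, locus p x -> locus p y -> locus p z ->
     V (env2 x y) -> V (env2 x z) -> V (env2 y z)) ->
  (forall x y, V (env2 x y) -> V (env2 y x)) ->
  strict_linear (locus p) lt ->
  (forall g x y, fixes g -> lt x y <-> lt (g s x) (g s y)) ->
  (forall x, over_b x -> V (env2 a x)) ->
  locus p x0 -> V (env2 a x0) ->
  (forall z, locus p z -> V (env2 a z) -> wle lt x0 z -> psat phi (env1 z)) ->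
  ~ divides m phi.
Proof.
move=> dV Veucl Vsym ltX lt_fix Vb px0 Vx0 tail [k [c [tpc incons]]].
have pa : locus p a by exact: locus_refl.
(* Inside the locus the class of [a] is only relatively definable. Compactness supplies [W] in p
   such that points of [W] related to [a] have the same neighbours in [W] as [a]; the definable set
   [Y] below then stands for the class and can be coded. *)
have [|||||W [W' [dW Wa _ _ WV]]] := type_compact (F := [set mk_elt a])
  (Bad := fun w : env M [:: s; s] => ~ (V (env2 a w.1) ->
     (V (env2 a w.2.1) <-> V (env2 w.1 w.2.1))))
  (c1 := env1 a) (l1 := [:: fun w : env M [:: s; s] => env1 w.1;
                            fun w : env M [:: s; s] => env1 w.2.1])
  (c2 := tt : env M [::]) (l2 := [::]).
- exact: finite_set1.
- have sB : B `<=` B `|` [set mk_elt a] by left.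
  have d1 : definable (B `|` [set mk_elt a]) (fun w : env M [:: s; s] => V (env2 a w.1)).
    by apply: (definable_subst (F := fun w : env M [:: s; s] => env2 a w.1) dV sB);
      rewrite /env2; param_auto.
  have d2 : definable (B `|` [set mk_elt a]) (fun w : env M [:: s; s] => V (env2 a w.2.1)).
    by apply: (definable_subst (F := fun w : env M [:: s; s] => env2 a w.2.1) dV sB);
      rewrite /env2; param_auto.
  have d3 : definable (B `|` [set mk_elt a]) (fun w : env M [:: s; s] => V (env2 w.1 w.2.1)).
    by apply: (definable_subst (F := fun w : env M [:: s; s] => env2 w.1 w.2.1) dV sB);
      rewrite /env2; param_auto.
  by apply: definable_not; apply: definable_imp d1 (definable_iff d2 d3).
- by rewrite /env1; split; [param_auto|split=> //; param_auto].
- by [].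
- move=> [x [z []]] H _ /=; apply=> Vax.
  have px : locus p x.
    by move=> psi [/definable_psat dpsi psia]; case: (H _ dpsi psia).
  have pz : locus p z.
    by move=> psi [/definable_psat dpsi psia]; case: (H _ dpsi psia) => _ [].
  split=> [|Vxz]; first exact: Veucl.
  by apply: (Veucl x) => //; exact: Vsym.
have {}WV x z : W (env1 x) -> W (env1 z) -> V (env2 a x) ->
    (V (env2 a z) <-> V (env2 x z)).
  move=> Wx Wz; have H := WV (env2 x z).
  by have := contrapT (fun N => H (conj Wx (conj Wz Logic.I)) Logic.I N).
pose Y (z : env M [:: s]) := W z /\ V (env2 a z.1).
have dY : definable (B `|` [set mk_elt a]) Y.
  apply: definable_and; first by apply: definable_sub dW; left.
  apply: (definable_subst (F := fun z : env M [:: s] => env2 a z.1) dV).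
    by left.
  by rewrite /env2; param_auto.
have [e eP] := M_canonical dY.
have pW x : locus p x -> W (env1 x) by move=> px; apply/(locus_definable px dW).
have Yfix g : fixes g -> V (env2 a (g s a)) ->
    forall z, Y z <-> Y (env_map g z).
  move=> fg Vga [z []].
  have Wz := fixes_definable (env1 z) fg dW.
  have Vz := fixes_definable (env2 a z) fg dV.
  have Wga : W (env1 (g s a)) by apply: pW; exact: (locus_fixes a _ fg).1.
  split=> -[/= W1 V1].
    have W2 := Wz.1 W1; split=> //=; apply/(WV _ _ Wga W2 Vga).
    exact: Vz.1.
  by split; [exact: Wz.2|apply: Vz.2; apply/(WV _ _ Wga W1 Vga)].
(* An automorphism fixing [a] preserves the class of [a]. One fixing [b] moves [a] inside [over_b],
   hence inside its class. *)
have me : m e.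
  split; apply: fixed_dcl => g fg gx; apply/(eP g fg.1); apply: Yfix => //.
    by rewrite gx; apply: (Veucl x0) => //; exact: Vsym.
  by apply: Vb; exists g.
(* Since [e] is in [m] and [c j] has the type of the parameters of [phi] over [m], they are
   conjugate over [B] and [e]. *)
have /choice[g gP] : forall j : nat, exists g,
    [/\ fixes g, g _ (projT2 e) = projT2 e & env_map g (pval phi) = c j].
  move=> j; pose G := projT1 e :: pctx phi.
  have [|h fh [he hc]] := M_homogeneous
    (c := (projT2 e, pval phi) : env M G) (d := (projT2 e, c j) : env M G).
    move=> P dP Pphi.
    have dPe : definable m (fun y : env M (pctx phi) => P (projT2 e, y)).
      apply: (definable_subst (F := fun y : env M (pctx phi) => (projT2 e, y) : env M G) dP).
        exact: sub_meet_dcl.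
      split; last exact: param_map_id.
      by apply: param_fun_const; rewrite /=; case: (e) me.
    have [psi [mpsi psiE]] := (definable_pformula _ _).1 dPe.
    have : tp m (pval phi) psi by split=> //; apply/psiE.
    by rewrite -(tpc j) => -[_ /psiE].
  by exists h.
(* The first [k] conjugates of [x0] stay in the class and have an upper bound [ub] there. Pulled
   back by any [g j] it lies in the class beyond [x0], where [phi] holds; hence [ub] satisfies the
   first [k] conjugates of [phi]. *)
have [|ub [pub Vub] ubP] := finite_upper_bound
  (strict_linear_sub (Y := [set x | locus p x /\ V (env2 a x)]) ltX (fun x => @proj1 _ _))
  (f := fun j : 'I_k => g j s x0) (ex_intro _ x0 (conj px0 Vx0)).
  move=> j; have [fg ge _] := gP j.
  have YE := (eP _ fg.1).1 ge (env1 x0).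
  have [_ /= Vg] := YE.1 (conj (pW _ px0) Vx0).
  by split=> //; exact: (locus_fixes a x0 fg).1.
apply: (incons (fun j => j : nat)); first exact: val_inj.
exists (env1 ub) => j; have [fg ge <-] := gP j.
have [u gu] := automorphism_surj fg.1 ub.
have pu : locus p u by apply/(locus_fixes a u fg); rewrite gu.
have Vu : V (env2 a u).
  have YE := (eP _ fg.1).1 ge (env1 u).
  by have [] := YE.2; rewrite /Y /= ?gu //; split=> //; exact: pW.
have phiu : psat phi (env1 u).
  apply: tail => //; have := ubP j; rewrite -gu => -[E|gxu].
    by left; exact: (automorphism_inj fg.1 E).
  by right; apply/(lt_fix (g j)).
rewrite -gu; case: (phi) phiu => D psi v phiu /=.
exact: (automorphism_psat fg.1 psi v (env1 u)).1.
Qed.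


Lemma definable_forall_ord B' G n (P : 'I_n -> env M G -> Prop) :
  (forall i, definable B' (P i)) -> definable B' (fun w => forall i, P i w).
Proof.
elim: n P => [|n IH] P dP.
  by apply: definable_ext (definable_True B' G) => w; split=> // _ [].
have := definable_and (dP ord0) (IH _ (fun i => dP (lift ord0 i))).
apply: definable_ext => w; split=> [[H0 H] i|H]; last by split.
by case: (unliftP ord0 i) => [j ->|->].
Qed.

Lemma not_forks_over_meet lt ltq :
  wom_pair B p lt -> wom_pair B q ltq -> simple_semiintervals B p ->
  ~ forks m (tp (m `|` [set mk_elt b]) (env1 a)).
Proof.
move=> lt_wom ltq_wom simple [n [phi [phi_div cover]]].
have ltX := wom_linear lt_wom.
have pa : locus p a by exact: locus_refl.
have qb : locus q b by exact: locus_refl.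
have [Z dZ ltZ] : exists2 Z : env M [:: s; s] -> Prop, definable B Z &
    forall x y, lt x y <-> [/\ Z (env2 x y), locus p x & locus p y].
  by apply: rel_definable2P; case: lt_wom.
(* Formulas cannot refer to the locus, so [ule] replaces the weak order in them; the two agree on
   realizations of p. *)
pose ule x y := x = y \/ Z (env2 x y).
have wleE x y : locus p x -> locus p y -> wle lt x y <-> ule x y.
  move=> px py; split=> -[|H]; try by left.
    by right; have [] := (ltZ x y).1 H.
  by right; apply/ltZ.
have ZB B' D (f g : env M D -> M s) : B `<=` B' -> param_fun B' f ->
    param_fun B' g -> definable B' (fun w => Z (env2 (f w) (g w))).
  move=> sB pf pg.
  by apply: (definable_subst (F := fun w => env2 (f w) (g w)) dZ sB).
have uleB B' D (f g : env M D -> M s) : B `<=` B' -> param_fun B' f ->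
    param_fun B' g -> definable B' (fun w => ule (f w) (g w)).
  by move=> sB pf pg; apply: definable_or; [exact: definable_eq|exact: ZB].
(* [Z] is known to be transitive on the locus only. Compactness extends this to some [W] in p, as
   needed for the endpoints of the convex hulls below, which need not realize p. *)
have [|||||W [T1 [dW Wa _ _ W_trans]]] := type_compact (F := set0)
  (Bad := fun w : env M [:: s; s; s] => ~ (Z (env2 w.1 w.2.1) ->
     Z (env2 w.2.1 w.2.2.1) -> Z (env2 w.1 w.2.2.1)))
  (c1 := env1 a) (l1 := [:: fun w : env M [:: s; s; s] => env1 w.1;
     fun w : env M [:: s; s; s] => env1 w.2.1;
     fun w : env M [:: s; s; s] => env1 w.2.2.1])
  (c2 := tt : env M [::]) (l2 := [::]).
- exact: finite_set0.
- apply: definable_not; do 2?[apply: definable_imp]; apply: ZB;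
    by [left|param_fun_auto].
- by rewrite /env1; do 3?[split; first by param_auto].
- by [].
- move=> [x [y [z []]]] H _ /=; apply=> xy yz.
  have [px py pz] : [/\ locus p x, locus p y & locus p z].
    by split=> psi [/definable_psat dpsi psia]; case: (H _ dpsi psia) => [? [? []]].
  have [_ tr _] := ltX.
  by have /ltZ[] : lt x z by apply: (tr x y z) => //; apply/ltZ.
have {}W_trans x y z : W (env1 x) -> W (env1 y) -> W (env1 z) ->
    Z (env2 x y) -> Z (env2 y z) -> Z (env2 x z).
  move=> Wx Wy Wz; have H := W_trans (x, (y, (z, tt))).
  exact: (contrapT (H (conj Wx (conj Wy (conj Wz Logic.I))) Logic.I)).
have pW x : locus p x -> W (env1 x) by move=> px; apply/(locus_definable px dW).
pose Fphi := [set mk_elt b] `|` \bigcup_i env_elts (pval (phi i)).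
(* The disjunction of the [phi i] holds on all of [over_b], hence on the solutions of one formula of
   the type of [a] over [B] and [b]. *)
have [|||||D0 [T2 [dD0 D0ab _ _ D0phi]]] := type_compact (F := Fphi)
  (Bad := fun w : env M [:: s] => forall i, ~ psat (phi i) w)
  (c1 := env2 a b) (l1 := [:: fun w : env M [:: s] => env2 w.1 b])
  (c2 := tt : env M [::]) (l2 := [::]).
- rewrite finite_setU; split; first exact: finite_set1.
  by apply: bigcup_finite => [|i _]; [exact: finite_finset|exact: finite_env_elts].
- apply: definable_forall_ord => i; apply: definable_not; apply: definable_psat.
  apply/env_in_eltsP => e ei; right; right; by exists i.
- by split=> //; rewrite /env2 /Fphi; param_auto.
- by [].
- move=> [x []] H _ /= NP.
  have bx : over_b x by apply/over_bP => Y dY Yab; case: (H Y dY Yab).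
  by have [i] := cover _ (over_b_realizes bx); exact: NP.
have {}D0phi x : D0 (env2 x b) -> exists i, psat (phi i) (env1 x).
  move=> Dx; apply: contrapT => H; apply: (D0phi (env1 x)) => // i phix.
  by apply: H; exists i.
(* As [over_b] is convex, a smaller formula [D1] of the same type has its convex hull, within p,
   inside [D0]. *)
have [|||||D1 [W1 [dD1 D1ab dW1 W1a D1D0]]] := type_compact (F := [set mk_elt b])
  (Bad := fun w : env M [:: s; s; s] => ule w.1 w.2.2.1 /\
     (ule w.2.2.1 w.2.1 /\ ~ D0 (env2 w.2.2.1 b)))
  (c1 := env2 a b) (l1 := [:: fun w : env M [:: s; s; s] => env2 w.1 b;
                              fun w : env M [:: s; s; s] => env2 w.2.1 b])
  (c2 := env1 a) (l2 := [:: fun w : env M [:: s; s; s] => env1 w.2.2.1]).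
- exact: finite_set1.
- have sB : B `<=` B `|` [set mk_elt b] by left.
  apply: definable_and; first by apply: uleB => //; param_fun_auto.
  apply: definable_and; first by apply: uleB => //; param_fun_auto.
  apply: definable_not.
  apply: (definable_subst (F := fun w : env M [:: s; s; s] => env2 w.2.2.1 b)) => //.
  by rewrite /env2; param_auto.
- by rewrite /env2; do 2?[split; first by param_auto].
- by split=> //; rewrite /env1; param_auto.
- move=> [u [v [y []]]] H H' /= [uy [yv NDy]].
  have bu : over_b u by apply/over_bP => Y dY Yab; case: (H Y dY Yab).
  have bv : over_b v by apply/over_bP => Y dY Yab; case: (H Y dY Yab) => _ [].
  have py : locus p y.
    by move=> psi [/definable_psat dpsi psia]; case: (H' _ dpsi psia).
  have [pu pv] := (over_b_locus bu, over_b_locus bv).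
  suff /over_bP by_ : over_b y by apply: NDy; exact: by_.
  case/(wleE _ _ pu py): uy => [<-//|uy].
  case/(wleE _ _ py pv): yv => [->//|yv].
  exact: over_b_convex lt_wom bu bv py uy yv.
have {}D1D0 u v y : D1 (env2 u b) -> D1 (env2 v b) -> W1 (env1 y) ->
    ule u y -> ule y v -> D0 (env2 y b).
  move=> Du Dv Wy uy yv; apply: contrapT => ND.
  by apply: (D1D0 (u, (v, (y, tt)))).
(* [DD x z] says that [x] lies in the convex hull of the set [D2 _ z]; on the
   realizations of [p], [DD _ b] is contained in [D0 _ b] by the choice of [D1]. *)
pose D2 (u : M s) (z : M t) := D1 (env2 u z) /\ W (env1 u).
pose psi (w : env M [:: s; t]) := exists u v,
  (D2 u w.2.1 /\ D2 v w.2.1) /\ (ule u w.1 /\ ule w.1 v).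
have dpsi : definable B psi.
  have sBB : B `<=` B by [].
  have dD2 D (f : env M D -> M s) (g : env M D -> M t) :
      param_fun B f -> param_fun B g -> definable B (fun w => D2 (f w) (g w)).
    move=> pf pg; apply: definable_and.
      by apply: (definable_subst (F := fun w => env2 (f w) (g w)) dD1 sBB).
    by apply: (definable_subst (F := fun w => env1 (f w)) dW sBB).
  apply: (definable_ex (P := fun w : env M [:: s; s; t] => exists v,
    (D2 w.1 w.2.2.1 /\ D2 v w.2.2.1) /\ (ule w.1 w.2.1 /\ ule w.2.1 v))).
  apply: (definable_ex (P := fun w : env M [:: s; s; s; t] =>
    (D2 w.2.1 w.2.2.2.1 /\ D2 w.1 w.2.2.2.1) /\
    (ule w.2.1 w.2.2.1 /\ ule w.2.2.1 w.1))).
  by do 2!apply: definable_and; do ?[apply: dD2|apply: uleB => //]; param_fun_auto.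
pose DD x z := psi (env2 x z).
have ule_lt x y z : W (env1 x) -> locus p y -> locus p z -> ule x y -> lt y z ->
    ule x z.
  move=> Wx py pz + /ltZ[yz _ _] => -[->|xy]; right=> //.
  by apply: (W_trans x y z) => //; exact: pW.
have lt_ule x y z : locus p x -> locus p y -> W (env1 z) -> lt x y -> ule y z ->
    ule x z.
  move=> px py Wz /ltZ[xy _ _] [<-|yz]; right=> //.
  by apply: (W_trans x y z) => //; exact: pW.
have DD_convex x y w z : locus p x -> locus p y -> locus p w ->
    lt x w -> lt w y -> DD x z -> DD y z -> DD w z.
  move=> px py pw xw wy [u [_ [[Du _] [/= ux _]]]] [_ [v [[_ Dv] [/= _ yv]]]].
  exists u, v; split=> //=; split; first by apply: (ule_lt _ x) => //; exact: Du.2.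
  by apply: (lt_ule _ y) => //; exact: Dv.2.
have DD_over_b x : over_b x -> DD x b.
  move=> bx; have px := over_b_locus bx.
  have Dx : D2 x b by split; [exact: (over_bP x).1 bx _ dD1 D1ab|exact: pW].
  by exists x, x; split; split=> //; left.
have DD_phi y : locus p y -> DD y b -> exists i, psat (phi i) (env1 y).
  move=> py [u [v [[[Du _] [Dv _]] [uy yv]]]]; apply: D0phi.
  by apply: (D1D0 u v) => //; apply/(locus_definable py dW1).
have DDab : DD a b by apply: DD_over_b; exact: over_b_refl.
have DD_fix g x z : fixes g -> DD x z <-> DD (g s x) (g t z).
  by move=> fg; exact: (fixes_definable (env2 x z) fg dpsi).
pose V (chi : env M [:: t] -> Prop) (w : env M [:: s; s]) :=
  exists z, chi (env1 z) /\ (DD w.1 z /\ DD w.2.1 z).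
have dV chi : definable B chi -> definable B (V chi).
  move=> dchi.
  apply: (definable_ex (P := fun w : env M [:: t; s; s] =>
    chi (env1 w.1) /\ (psi (env2 w.2.1 w.1) /\ psi (env2 w.2.2.1 w.1)))).
  have sBB : B `<=` B by [].
  apply: definable_and.
    by apply: (definable_subst (F := fun w : env M [:: t; s; s] => env1 w.1) dchi sBB);
      rewrite /env1; param_auto.
  apply: definable_and.
    by apply: (definable_subst (F := fun w : env M [:: t; s; s] => env2 w.2.1 w.1) dpsi sBB);
      rewrite /env2; param_auto.
  by apply: (definable_subst (F := fun w : env M [:: t; s; s] => env2 w.2.2.1 w.1) dpsi sBB);
    rewrite /env2; param_auto.
have V_sym chi x y : V chi (env2 x y) -> V chi (env2 y x).
  by move=> [z [? [? ?]]]; exists z.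
have V_eucl chi : definable B chi -> chi (env1 b) -> forall x y z,
    locus p x -> locus p y -> locus p z ->
    V chi (env2 x y) -> V chi (env2 x z) -> V chi (env2 y z).
  move=> dchi chib.
  have Vaa : V chi (env2 a a) by exists b.
  pose S : set (M s) := [set y | locus p y /\ (wle lt a y /\ V chi (env2 a y))].
  have semi : semiinterval B p lt S.
    split; first split=> [y []//|x y z [px [ax Vx]] [py [ay [w [chiw [aw yw]]]]] pz xz zy].
      split=> //; have az : lt a z := wle_lt_trans ltX pa px pz ax xz.
      split; first by right.
      by exists w; do 2!split=> //; exact: (DD_convex a y).
    exists a; split; first by split=> [|y [_ [ay _]]]; [split=> //; split=> //; left|].
    have dS : definable (B `|` [set mk_elt a]) (fun w : env M [:: s] =>
        ule a w.1 /\ V chi (env2 a w.1)).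
      apply: definable_and.
        by apply: uleB; [left|apply: param_fun_const; right|exact: (param_fun_lookup _ (VZ _ _))].
      by apply: (definable_subst (F := fun w : env M [:: s] => env2 a w.1) (dV _ dchi));
        [left|rewrite /env2; param_auto].
    have [xi [Bxi xiE]] := (definable_pformula _ _).1 dS.
    exists xi; split=> //; apply/seteqP; split=> -[y []] /=.
      move=> [py [ay Vy]]; split=> //; apply: (xiE (env1 y)).2; split=> //.
      by apply/wleE.
    by move=> [/xiE[/= ay Vy] [py _]]; split=> //; split=> //; apply/wleE.
  (* This is the only use of simplicity of semiintervals. *)
  have [a' [E [[Sa' mina'] [rE Erefl Esym Etrans] SE]]] := simple lt lt_wom S semi.
  have Sa : S a by split=> //; split=> //; left.
  have aa' : a' = a.
    case: (mina' a Sa) => // a'a; have [pa' [aa' _]] := Sa'.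
    by case: (not_lt_wle ltX pa' pa a'a aa').
  have VE0 y : locus p y -> wle lt a y -> V chi (env2 a y) <-> E a y.
    move=> py ay; rewrite aa' in SE; split=> [Vy|Ey].
      by have : S y by []; rewrite SE => -[].
    by have : S y by [rewrite SE]; move=> [_ []].
  (* Simplicity compares the two relations only from [a] upwards. An automorphism carries this to
     any [x], and the symmetry of both relations settles the points below [x]. *)
  have VE1 x y : locus p x -> locus p y -> wle lt x y -> V chi (env2 x y) <-> E x y.
    move=> px py xy; have [g fg gax] := locus_transitive pa px.
    have [y' gy'] := automorphism_surj fg.1 y.
    have py' : locus p y' by apply/(locus_fixes a y' fg); rewrite gy'.
    have ay' : wle lt a y'.
      apply/(wle_symmetry ltX (fixes_order_symmetry lt_wom fg)) => //.
      by rewrite gax gy'.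
    rewrite -gax -gy' -(rel_definable2_fixes _ _ rE fg) -VE0 //.
    by have := fixes_definable (env2 a y') fg (dV _ dchi) => ->.
  have VE x y : locus p x -> locus p y -> V chi (env2 x y) <-> E x y.
    move=> px py; have [xy|yx] := wle_total ltX px py; first exact: VE1.
    by split=> [/V_sym/(VE1 _ _ py px yx).1/Esym|/Esym/(VE1 _ _ py px yx).2/V_sym].
  move=> x y z px py pz /(VE _ _ px py) xy /(VE _ _ px pz) xz.
  by apply/VE => //; apply: Etrans xz; exact: Esym.
(* Here [lt'] is to be [lt] or its reverse. If the part of the class of [a] from [a] on lay in the
   fiber over [b], one of the [phi i] would be cofinal in that part, hence contain a final segment
   of the class, and could not divide. *)
have final lt' : strict_linear (locus p) lt' ->
    (forall g x y, fixes g -> lt' x y <-> lt' (g s x) (g s y)) ->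
    (forall B' P, definable B' P ->
       convex_union (locus p) lt' [set x | P (env1 x) /\ locus p x]) ->
    forall chi, definable B chi -> chi (env1 b) ->
    ~ forall y, locus p y -> wle lt' a y -> V chi (env2 a y) -> DD y b.
  move=> ltX' lt'_fix lt'_union chi dchi chib H.
  pose X := [set x | (locus p x /\ V chi (env2 a x)) /\ wle lt' a x].
  have Xp : X `<=` locus p by move=> x [[]].
  have Xa : X a by split; [split=> //; exists b|left].
  have [x Xx|i ci] := cofinal_member (strict_linear_sub ltX' Xp)
      (Z := fun i => [set x | psat (phi i) (env1 x)]) (ex_intro _ a Xa).
    have [[px Vx] ax] := Xx; have [i phix] := DD_phi x px (H x px ax Vx).
    by exists i, x; split=> //; left.
  have dphi : definable setT (psat (phi i)).
    by apply: definable_psat; apply/env_in_eltsP.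
  have [x Xx|x0 [[px0 Vx0] ax0] tail] := cofinal_tail ltX' Xp (ex_intro _ a Xa)
      (lt'_union _ _ dphi).
    by have [y [Xy xy phiy]] := ci x Xx; exists y; split=> //; split=> //; exact: Xp.
  apply: (final_segment_not_divides (dV _ dchi) (V_eucl _ dchi chib) _ ltX' lt'_fix
    _ px0 Vx0) (phi_div i); first exact: V_sym.
    by move=> x bx; exists b; do 2!split=> //; exact: DD_over_b.
  move=> z pz Vz x0z; apply: (tail z _ x0z).1; split=> //.
  exact: (wle_trans ltX' pa px0 pz).
(* For each chi some point of [R] is [V chi]-related to [a] but outside the fiber over [b]. By
   compactness, one such point shares with [a] a fiber over a realization of q. *)
have far (R : M s -> Prop) :
    definable (B `|` [set mk_elt a; mk_elt b]) (fun w : env M [:: s; t] => R w.1) ->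
    (forall chi, definable B chi -> chi (env1 b) ->
      ~ forall y, locus p y -> R y -> V chi (env2 a y) -> DD y b) ->
    exists y, [/\ locus p y, R y, same_fiber (locus q) DD a y & ~ DD y b].
  move=> dR NR; apply: contrapT => H.
  have [|||||X1 [X2 [dX1 X1a dX2 X2b X12]]] := type_compact
    (F := [set mk_elt a; mk_elt b])
    (Bad := fun w : env M [:: s; t] => R w.1 /\ (psi (env2 a w.2.1) /\
       (psi (env2 w.1 w.2.1) /\ ~ psi (env2 w.1 b))))
    (c1 := env1 a) (l1 := [:: fun w : env M [:: s; t] => env1 w.1])
    (c2 := env1 b) (l2 := [:: fun w : env M [:: s; t] => env1 w.2.1]).
  - by rewrite finite_setU; split; exact: finite_set1.
  - have sB : B `<=` B `|` [set mk_elt a; mk_elt b] by left.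
    do 2?[apply: definable_and => //].
      by apply: (definable_subst (F := fun w : env M [:: s; t] => env2 a w.2.1) dpsi sB);
        rewrite /env2; param_auto.
    apply: definable_and.
      by apply: (definable_subst (F := fun w : env M [:: s; t] => env2 w.1 w.2.1) dpsi sB);
        rewrite /env2; param_auto.
    apply: definable_not.
    by apply: (definable_subst (F := fun w : env M [:: s; t] => env2 w.1 b) dpsi sB);
      rewrite /env2; param_auto.
  - by split=> //; rewrite /env1; param_auto.
  - by split=> //; rewrite /env1; param_auto.
  - move=> [y [z []]] H1 H2 [/= Ry [az [yz Nyb]]]; apply: H; exists y.
    have py : locus p y.
      by move=> xi [/definable_psat dxi xia]; case: (H1 _ dxi xia).
    split=> //; exists z; split=> //.
    by move=> xi [/definable_psat dxi xib]; case: (H2 _ dxi xib).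
  apply: (NR X2 dX2 X2b) => y py Ry [z [X2z [az yz]]].
  apply: contrapT => Nyb; apply: (X12 (env2 y z)) => //; split=> //.
  exact/(locus_definable py dX1).
have ltX' := strict_linear_flip ltX.
have sB2 : B `<=` B `|` [set mk_elt a; mk_elt b] by left.
have a_const : param_fun (B `|` [set mk_elt a; mk_elt b]) (fun _ : env M [:: s; t] => a).
  by apply: param_fun_const; right; left.
have fst_var : param_fun (B `|` [set mk_elt a; mk_elt b]) (fun w : env M [:: s; t] => w.1).
  exact: (param_fun_lookup _ (VZ _ _)).
have [d [pd ad sad Nd]] := far _ (uleB _ _ _ _ sB2 a_const fst_var) (fun chi dchi chib H =>
  final lt ltX (fun g x y => wom_fixes lt_wom x y) (wom_convex_union lt_wom) chi dchi chib
    (fun y py ay => H y py ((wleE _ _ pa py).1 ay))).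
have [c [pc ca sac Nc]] : exists y, [/\ locus p y, ule y a,
    same_fiber (locus q) DD a y & ~ DD y b].
  apply: far; first exact: uleB.
  move=> chi dchi chib H; apply: (final _ ltX' _ _ chi dchi chib).
  - by move=> g x y fg; exact: (wom_fixes lt_wom y x fg).
  - by move=> B' P dP; apply: convex_union_flip; exact: (wom_convex_union lt_wom dP).
  - move=> y py ay; apply: H => //; apply/wleE => //.
    by case: ay => [->|]; [left|right].
have {}ad : lt a d by case/(wleE _ _ pa pd): ad => // E; case: Nd; rewrite -E.
have {}ca : lt c a by case/(wleE _ _ pc pa): ca => // E; case: Nc; rewrite E.
(* The fiber over [b] is convex and contains [a], so the points [c] and [d] outside it, on either
   side of [a], bound it. *)
have d_bound y : locus p y -> DD y b -> lt y d.
  move=> py yb; apply: (not_wle_lt ltX) => // -[E|dy]; apply: Nd; first by rewrite E.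
  exact: (DD_convex a y).
have c_bound y : locus p y -> DD y b -> lt c y.
  move=> py yb; apply: (not_wle_lt ltX) => // -[E|yc]; apply: Nc; first by rewrite -E.
  exact: (DD_convex y a).
have V_of_fiber chi x y : definable B chi -> chi (env1 b) ->
    same_fiber (locus q) DD x y -> V chi (env2 x y).
  by move=> dchi chib [z [qz xz yz]]; exists z; split=> //;
    apply/(locus_definable qz dchi).
(* By compactness, sharing a fiber over a realization of q is the conjunction of all [V chi] with
   chi in q, each of which is transitive on the locus. *)
have sameT x y w : locus p x -> locus p y -> locus p w ->
    same_fiber (locus q) DD x y -> same_fiber (locus q) DD y w ->
    same_fiber (locus q) DD x w.
  move=> px py pw xy yw; apply: contrapT => H.
  have [|||||X1 [X2 [dX1 X1b _ _ NX]]] := type_compact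
    (F := [set mk_elt x; mk_elt w])
    (Bad := fun z : env M [:: t] => psi (env2 x z.1) /\ psi (env2 w z.1))
    (c1 := env1 b) (l1 := [:: fun z : env M [:: t] => env1 z.1])
    (c2 := tt : env M [::]) (l2 := [::]).
  - by rewrite finite_setU; split; exact: finite_set1.
  - have sB : B `<=` B `|` [set mk_elt x; mk_elt w] by left.
    apply: definable_and.
      by apply: (definable_subst (F := fun z : env M [:: t] => env2 x z.1) dpsi sB);
        rewrite /env2; param_auto.
    by apply: (definable_subst (F := fun z : env M [:: t] => env2 w z.1) dpsi sB);
      rewrite /env2; param_auto.
  - by split=> //; rewrite /env1; param_auto.
  - by [].
  - move=> [z []] H1 _ /= [xz wz]; apply: H; exists z; split=> //.
    by move=> xi [/definable_psat dxi xib]; case: (H1 _ dxi xib).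
  have [|z [X1z [xz wz]]] := V_eucl X1 dX1 X1b y x w py px pw _
      (V_of_fiber _ _ _ dX1 X1b yw).
    by apply: V_sym; exact: V_of_fiber.
  by apply: (NX (env1 z)).
have qg g : fixes g -> locus q (g t b) by move=> fg; exact: (locus_fixes b b fg).1.
(* An automorphism moves the bounds [c] and [d] of the fiber over [b] to bounds of the fiber over
   [z]; [sameT] relates them to an arbitrary [x] in that fiber. *)
have bounded x z : locus p x -> locus q z -> DD x z -> exists c d,
    [/\ locus p c, locus p d, same_fiber (locus q) DD x c,
        same_fiber (locus q) DD x d &
        forall y, locus p y -> DD y z -> lt c y /\ lt y d].
  move=> px /locusP[g fg gbz]; rewrite -{z}gbz => xz.
  have pg u : locus p u -> locus p (g s u) := (locus_fixes a u fg).1.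
  have same_g u : same_fiber (locus q) DD a u -> same_fiber (locus q) DD (g s a) (g s u).
    move=> [z [qz az uz]]; exists (g t z).
    by split; [exact: (locus_fixes b z fg).1|exact: (DD_fix _ _ _ fg).1 az|
      exact: (DD_fix _ _ _ fg).1 uz].
  have sxa : same_fiber (locus q) DD x (g s a).
    by exists (g t b); split=> //; [exact: qg|exact: (DD_fix _ _ _ fg).1 DDab].
  have sx u : locus p u -> same_fiber (locus q) DD a u ->
      same_fiber (locus q) DD x (g s u).
    move=> pu au; apply: (sameT x (g s a)) => //; [exact: pg|exact: pg|exact: same_g].
  exists (g s c), (g s d); split; [exact: pg|exact: pg|exact: sx|exact: sx|].
  move=> y + yz; have [u guy] := automorphism_surj fg.1 y; rewrite -{y}guy in yz *.
  move=> /(locus_fixes a u fg).2 pu; have ub := (DD_fix g u b fg).2 yz.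
  split; first exact: (wom_fixes lt_wom c u fg).1 (c_bound u pu ub).
  exact: (wom_fixes lt_wom u d fg).1 (d_bound u pu ub).
have sameR x : locus p x -> same_fiber (locus q) DD x x.
  move=> /locusP[g fg <-]; exists (g t b).
  by split; [exact: qg|exact: (DD_fix _ _ _ fg).1 DDab|exact: (DD_fix _ _ _ fg).1 DDab].
have trans x y : locus p x -> locus p y -> exists g h,
    family_symmetry (locus p) (locus q) lt DD ltq g h /\ g x = y.
  move=> px py; have [g fg gxy] := locus_transitive px py.
  exists (g s), (g t); split=> //; split.
  - exact: (fixes_order_symmetry lt_wom fg).
  - exact: (fixes_order_symmetry ltq_wom fg).
  - by move=> x' z; exact: DD_fix.
have union x : locus p x -> convex_union (locus q) ltq [set z | locus q z /\ DD x z].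
  move=> px; have dx : definable (B `|` [set mk_elt x]) (fun z : env M [:: t] => psi (env2 x z.1)).
    by apply: (definable_subst (F := fun z : env M [:: t] => env2 x z.1) dpsi);
      [left|rewrite /env2; param_auto].
  have [k [Y [cY YE]]] := wom_convex_union ltq_wom dx.
  by exists k, Y; split=> //; rewrite -YE; apply/seteqP; split=> z [].
exact: (no_bounded_transitive_family ltX (fun x y w z px py pw _ => DD_convex x y w z px py pw)
  sameT bounded (wom_linear ltq_wom) union sameR trans pa).
Qed.

End TwoTypes.

End SaturatedHomogeneous.

(** * Infinitude of the monster's cardinal and conclusion *)

Fixpoint formula_depth (L : signature) G (phi : formula (L := L) G) : nat :=
  match phi with
  | FImp _ psi _ => (formula_depth psi).+1
  | _ => 0
  end.

(** The iterated negations of falsity, told apart by [formula_depth], are already infinitely many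
    formulas in any signature. *)
Lemma small_formulas_infinite (L : signature) (K : Type) :
  small K [set: {G : seq (sorts L) & formula G}] -> infinite_set [set: K].
Proof.
move=> sK /finite_set_countable Kc; apply: sK; apply: card_le_trans Kc _.
pose phi n : formula (L := L) [::] := iter n (@FNot L [::]) (FFalse [::]).
have phiK : cancel phi (@formula_depth L [::]) by elim=> //= n ->.
apply/card_le_fun; first by constructor; exists [::]; exact: FFalse.
exists (fun n => existT _ [::] (phi n)) => // n k E.
by have := congr1 (fun f => formula_depth (projT2 f)) E; rewrite /= !phiK.
Qed.

Theorem proposition2p24 (L : signature) (T : theory L) (hT : complete_theory T)
    (K : Type) (C : structure L) (hC : monster K T C)
    (A : set (elt C)) (hA : small K A) (a b : elt (eq_structure C))
    (ha : Wss (@home L C @` A) a) (hb : W (@home L C @` A) b) :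
  independent (meet_dcl (@home L C @` A) a b) a b.
Proof.
have [_ /small_formulas_infinite Kinf Csat Chom] := hC.
case: a b ha hb => s a [t b] [[lt lt_wom] simple] [ltq ltq_wom].
apply: (not_forks_over_meet _ _ _ lt_wom ltq_wom simple).
- by move=> G F I X; exact: (eq_compact Kinf Csat hA).
- move=> G c d cd; have [g [ag gA gcd]] := eq_homogeneous Kinf Csat Chom hA cd.
  by exists g.
- by move=> B' G Y; exact: (@canonical_parameter L C B' G Y).
Qed.
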